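(* Let $p=\frac12\gamma$. There exists a $c_0>0$ such that the following implication is true. If $a:[0,T(a_0)]\to\mathbb{R}$ solves $$\dot a=-c_0a^{1-p},\qquad a(0)=a_0>0,$$ with $a_0<1$ and $T(a_0)>0$ being the unique time such that $$a(T(a_0))=0,\qquad a(t)>0\ \text{ for } t<T(a_0),$$ and if $\omega$ is a smooth solution of $$\omega_t+u[\omega]\,\omega_x=0$$ such that $$\|\omega(0,\cdot)\|_p+\|\omega_x(0,\cdot)\|_{p-1}<\infty,\qquad \omega(0,x)>(1+\epsilon)\phi(0,x)\quad(x>0)$$ for $\epsilon>0$ satisfying $$\epsilon>(1-a_0^p)^{-1}-1,$$ then $\bar T\le T(a_0)$ and $$\omega(t,x)>\phi(t,x)\quad(x>0)$$ for $0\le t<\bar T$, where $\bar T>0$ denotes the maximal lifetime of the smooth solution. Provided $\omega$ does not break down earlier, $\omega$ forms at least a cusp at time $t=T(a_0)$ (or a potentially stronger singularity).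
   Context: Let $\alpha\in(0,1)$ and $\gamma=1-\alpha$. The barrier is $$\phi(t,x)=a(t)^p f\!\left(\frac{x}{a(t)}\right),\qquad f(z)=(z+1)^p-1 .$$ For $s\in\mathbb{R}$, $\|g\|_s:=\sup_{x\ge0}|g(x)|(1+x)^{-s}$. The unknown $\omega(t,x)$, $x\in\mathbb{R}$, is odd in $x$, and the velocity is $u[\omega]=(-\Delta)^{-\alpha/2}\omega$ with the constant of the fractional Laplacian normalized to $1$, i.e. $$u[\omega](t,x)=-\int_{\mathbb{R}}|y-x|^{-\gamma}\omega(t,y)\,dy=-\int_0^\infty\left(\frac{1}{|y-x|^\gamma}-\frac{1}{|x+y|^\gamma}\right)\omega(t,y)\,dy ,$$ where the second form uses the oddness of $\omega$ and is the one that defines $u[\omega]$. Standing assumptions: the initial data $\omega_0=\omega(0,\cdot)$ are odd, $C^2$, and satisfy $\|\omega_0\|_q+\|\partial_x\omega_0\|_{q-1}+\|\partial_x^2\omega_0\|_{q-2}<\infty$ for some $0<q<\gamma$; solutions are classical, odd in $x$, with $\|\omega(t,\cdot)\|_q+\|\omega_x(t,\cdot)\|_{q-1}<\infty$ for all times $t$ in the interval of existence considered. Formation of an (odd) cusp is described informally as a smooth solution becoming singular at a time $T_s>0$ in a way such that $\omega\sim\operatorname{sign}(x)|x|^p$ as $t\to T_s$, with some power $p\in(0,1)$. *)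

(* Defs.v *)
(* MathComp-Analysis, over an arbitrary realType R. *)
From HB Require Import structures.
From mathcomp Require Import all_boot all_order all_algebra.
From mathcomp Require Import all_classical all_reals all_analysis.

Set Implicit Arguments.
Unset Strict Implicit.
Unset Printing Implicit Defensive.

Import Order.TTheory GRing.Theory Num.Theory.
Import numFieldNormedType.Exports.
Local Open Scope classical_set_scope.
Local Open Scope ring_scope.

(* The norm ||g||_s; finiteness of the norm is the statement < +oo. *)
Definition wnorm (R : realType) (s : R) (g : R -> R) : \bar R :=
  ereal_sup [set (`|g x| * (1 + x) `^ (- s))%:E | x in [set x | 0 <= x]].

(* The velocity at x generated by an odd profile g, in the form that uses
   oddness; gamma = 1 - alpha. The library's conventions at the singularity
   y = x (0 `^ gamma = 0 for gamma <> 0 and 0^-1 = 0) only concern a null set. *)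
Definition velocity (R : realType) (gamma : R) (g : R -> R) (x : R) : R :=
  - \int[lebesgue_measure]_(y in `[0, +oo[)
      (((`|y - x| `^ gamma)^-1 - (`|x + y| `^ gamma)^-1) * g y).

Definition barrier_profile (R : realType) (p z : R) : R := (z + 1) `^ p - 1.

Definition barrier (R : realType) (p : R) (a : R -> R) (t x : R) : R :=
  a t `^ p * barrier_profile p (x / a t).

(* A function of (t, x) is written w : R -> R -> R, w t being the spatial
   profile at time t; only the values at times of the interval under
   consideration matter. *)
Definition dx (R : realType) (w : R -> R -> R) (t x : R) : R := derive1 (w t) x.

Definition dt (R : realType) (w : R -> R -> R) (t x : R) : R :=
  derive1 (fun s => w s x) t.

Definition odd_fun (R : realType) (g : R -> R) : Prop :=
  forall x, g (- x) = - g x.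

Definition admissible_data (R : realType) (q : R) (w0 : R -> R) : Prop :=
  [/\ odd_fun w0,
      forall x, derivable w0 x 1,
      forall x, derivable (derive1 w0) x 1,
      continuous (derive1n 2 w0) &
      (wnorm q w0 + wnorm (q - 1)%R (derive1 w0)
         + wnorm (q - 2)%R (derive1n 2 w0) < +oo)%E].

(* Classical solution on the time interval [0, T[, T being possibly +oo:
   w and w_x are continuous up to t = 0, the equation holds for t > 0. *)
Definition smooth_solution (R : realType) (gamma q : R) (T : \bar R)
    (w : R -> R -> R) : Prop :=
  [/\ admissible_data q (w 0),
      forall t, 0 <= t -> (t%:E < T)%E -> odd_fun (w t),
      [/\ forall t x, 0 <= t -> (t%:E < T)%E -> derivable (w t) x 1,
          forall t x, 0 < t -> (t%:E < T)%E ->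
            derivable (fun s => w s x) t 1,
          {within [set z : R * R | 0 <= z.1 /\ (z.1%:E < T)%E],
            continuous (fun z => w z.1 z.2)},
          {within [set z : R * R | 0 <= z.1 /\ (z.1%:E < T)%E],
            continuous (fun z => dx w z.1 z.2)} &
          {within [set z : R * R | 0 < z.1 /\ (z.1%:E < T)%E],
            continuous (fun z => dt w z.1 z.2)}],
      forall t, 0 <= t -> (t%:E < T)%E ->
        (wnorm q (w t) + wnorm (q - 1)%R (dx w t) < +oo)%E &
      forall t x, 0 < t -> (t%:E < T)%E ->
        dt w t x + velocity gamma (w t) x * dx w t x = 0].

(* w is a smooth solution on [0, T[ with T > 0, and it is not the restriction
   of a smooth solution on a longer interval. *)
Definition maximal_smooth_solution (R : realType) (gamma q : R) (T : \bar R)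
    (w : R -> R -> R) : Prop :=
  [/\ (0 < T)%E,
      smooth_solution gamma q T w &
      forall (T' : \bar R) (w' : R -> R -> R), (T < T')%E ->
        smooth_solution gamma q T' w' ->
        ~ (forall t x, 0 <= t -> (t%:E < T)%E -> w' t x = w t x)].

(* a solves a' = - c0 a^(1-p) on [0, T], a(0) = a0, and T is the first zero
   of a. Since the right-hand side is continuous in t, the equation on the open
   interval and continuity of a on the closed one give the one-sided equations
   at the endpoints. *)
Definition barrier_scale (R : realType) (p c0 a0 T : R) (a : R -> R) : Prop :=
  [/\ {within `[0, T], continuous a},
      forall t, 0 < t < T -> is_derive t 1 a (- c0 * a t `^ (1 - p)),
      a 0 = a0,
      a T = 0 &
      forall t, 0 <= t < T -> 0 < a t].

(* At least a cusp of power p at the origin as t -> T-: the slope at the origin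
   blows up and, in the limit, w lies above |x|^p for x > 0 and (by oddness)
   below - |x|^p for x < 0, uniformly in x. A behaviour w ~ sign(x) |x|^p is
   thus the mildest one allowed. *)
Definition at_least_cusp (R : realType) (p T : R) (w : R -> R -> R) : Prop :=
  (dx w t 0 @[t --> T^'-] --> +oo) /\
  (forall e : R, 0 < e ->
     \forall t \near T^'-, forall x : R, `|x| `^ p - e < Num.sg x * w t x).

(* Main.v *)
Require Import Defs.
From HB Require Import structures.
From mathcomp Require Import all_boot all_order all_algebra.
From mathcomp Require Import all_classical all_reals all_analysis.
From mathcomp Require Import measurable_realfun.
From mathcomp Require Import ring lra.

Set Implicit Arguments.
Unset Strict Implicit.
Unset Printing Implicit Defensive.

Import Order.TTheory GRing.Theory Num.Theory.
Import numFieldNormedType.Exports.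
Local Open Scope classical_set_scope.
Local Open Scope ring_scope.

(** Write psi_A(x) = (x + A)^p - A^p, so that the barrier at time t is psi_A
    with A = a(t), and K(x,y) = |y-x|^-gamma - |x+y|^-gamma for the kernel of
    the velocity, which is positive for x, y > 0.

    The barrier is a subsolution. If a profile lies above psi_A on the
    half-line, then positivity of K allows one to discard from the
    velocity integral everything but the window m < y <= 2m with m = max(x, A); this
    window alone pushes the point x > 0 towards the origin with a speed of at
    least cusp_rate * ((x + A)^(1-p) - A^(1-p)) ([cusp_velocity_le]). The
    powers fit together exactly because p = gamma / 2. With c0 equal to half
    of this rate, - u psi_x is at least 2 psi_t ([cusp_balance]): the solution
    rises at least twice as fast as the barrier wherever the two touch.

    The comparison itself is a first-touching argument ([first_touching]). To
    keep the contact points away from x = 0, where the solution and the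
    barrier always agree, and from infinity, the barrier is lowered by
    delta * exp(K t) * (1 + x)^r with max(q, p) < r < gamma; the error which
    this makes in the velocity is absorbed by a large K
    ([solution_ge_cusp]). As delta tends to 0 one gets w >= psi, and the spare
    factor 2 turns this into a strict inequality ([solution_gt_cusp]).

    Such an argument on an unbounded domain needs a bound on the growth of w
    which is uniform in time, whereas the norm of w(t) is only known to be
    finite for each t. The bound is obtained in two steps. Far from the
    origin the flow is slow: an envelope (rho + x)^q generates a velocity of
    size rho^(q-gamma) (rho + x), so for rho large it hardly moves during a
    prescribed time, and a growth bound at one end of a time interval
    propagates to the whole interval, provided that the growth is known to be
    bounded there by some constant, however large ([growth_envelope],
    [growth_propagation]). This proviso is removed by a Baire category
    argument: the set of times at which the norm is at most n is closed, and
    were the norm unbounded on some interval, one would find a nested sequence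
    of subintervals such that the norm exceeds n on the n-th one; it would be
    infinite at a common point ([uniform_of_propagation],
    [smooth_uniform_growth]).

    Finally, w >= psi with equality at x = 0 yields
    w_x(t,0) >= p a(t)^(p-1), which tends to infinity as t tends to T, so no
    smooth solution reaches beyond T; and psi_A(x) >= x^p - A^p gives the
    lower bound by the cusp. *)

(** * Integrals of powers near a singularity and at infinity *)

Lemma FTC2_of_is_derive (R : realType) (f F : R -> R) (a b : R) : a < b ->
  (forall y, a <= y <= b -> {for y, continuous f}) ->
  (forall y, a <= y <= b -> is_derive y 1 F (f y)) ->
  (\int[lebesgue_measure]_(y in `[a, b]) (f y)%:E = (F b - F a)%:E)%E.
Proof.
move=> ab cf dF.
have cF y : a <= y <= b -> {for y, continuous F}.
  move=> /dF dy; apply/differentiable_continuous/derivable1_diffP.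
  exact: ex_derive.
rewrite EFinB; apply: continuous_FTC2 => //.
- apply: continuous_in_subspaceT => y; rewrite inE/= in_itv/= => /cf; exact.
- split.
  + move=> y; rewrite in_itv/= => /andP[ay yb].
    have /dF dy : a <= y <= b by rewrite !ltW.
    exact: ex_derive.
  + by apply: cvg_at_right_filter; apply: cF; rewrite lexx ltW.
  + by apply: cvg_at_left_filter; apply: cF; rewrite lexx ltW.
- move=> y; rewrite in_itv/= => /andP[ay yb].
  have /dF dy : a <= y <= b by rewrite !ltW.
  by rewrite derive1E derive_val.
Qed.

(** Monotone convergence in the form needed for improper integrals: an upper
    bound on an exhausting sequence of sets passes to the limit set, with no
    need to compute a limit. *)
Lemma ge0_integral_exhaust_le d (T : measurableType d) (R : realType)
    (mu : {measure set T -> \bar R}) (E : (set T)^nat) (D : set T)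
    (f : T -> \bar R) (M : \bar R) :
  nondecreasing_seq E -> (forall i, measurable (E i)) -> D = \bigcup_i E i ->
  measurable_fun D f -> (forall x, D x -> 0 <= f x)%E ->
  (forall i, \int[mu]_(x in E i) f x <= M)%E ->
  (\int[mu]_(x in D) f x <= M)%E.
Proof.
move=> nE mE -> mf f0 leM.
have sE i : E i `<=` \bigcup_i E i by exact: bigcup_sup.
have mfE i : measurable_fun (E i) f.
  by apply: measurable_funS mf => //; exact: bigcup_measurable.
have f0E i x : E i x -> (0 <= f x)%E by move=> /sE/f0.
have cv := ge0_nondecreasing_set_cvg_integral (mu := mu) nE mE mfE f0E.
by rewrite -(cvg_lim (@ereal_hausdorff R) cv); apply: lime_le;
  [apply/cvg_ex; eexists; exact: cv | near=> n; exact: leM].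
Unshelve. all: by end_near. Qed.

Lemma powR_continuous_pos (R : realType) (s y : R) : 0 < y ->
  {for y, continuous (fun z : R => z `^ s)}.
Proof.
move=> y0; apply/differentiable_continuous/derivable1_diffP.
by apply: derivable_powR; rewrite in_itv/= andbT.
Qed.

Lemma is_derive_powR_shift (R : realType) (s x y : R) : x < y ->
  is_derive y 1 (fun z : R => (z - x) `^ s) (s * (y - x) `^ (s - 1)).
Proof.
move=> xy; have xy0 : 0 < y - x by rewrite subr_gt0.
have h := is_derive1_powR s xy0.
have g : is_derive y 1 (fun z : R => z - x) (1 : R).
  by apply: is_derive_eq; rewrite ?subr0.
have := @is_derive1_comp _ (fun z : R => z `^ s) (fun z : R => z - x) _ _ _ h g.
by rewrite mulr1.
Qed.

Lemma is_derive_powR_refl (R : realType) (s x y : R) : y < x ->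
  is_derive y 1 (fun z : R => (x - z) `^ s) (- (s * (x - y) `^ (s - 1))).
Proof.
move=> yx; have xy0 : 0 < x - y by rewrite subr_gt0.
have h := is_derive1_powR s xy0.
have g : is_derive y 1 (fun z : R => x - z) (- 1 : R).
  have := @is_deriveB _ _ _ (cst x) id y 1 0 1 (is_derive_cst x y 1) (is_derive_id y 1).
  by rewrite sub0r.
have := @is_derive1_comp _ (fun z : R => z `^ s) (fun z : R => x - z) _ _ _ h g.
by rewrite mulrN1.
Qed.

Lemma measurable_inv_dist_powR (R : realType) (g x : R) :
  measurable_fun [set: R] (fun y => (`|y - x| `^ g)^-1).
Proof.
under eq_fun do rewrite -powRN.
apply: (@measurableT_comp _ _ _ _ _ _ (fun z : R => z `^ (- g))) => //.
by apply: measurableT_comp => //; exact: measurable_funB.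
Qed.

Lemma integral_powR_right (R : realType) (g x b : R) : 0 < g < 1 -> x < b ->
  (\int[lebesgue_measure]_(y in `]x, b]) ((`|y - x| `^ g)^-1)%:E
    <= ((b - x) `^ (1 - g) / (1 - g))%:E)%E.
Proof.
move=> /andP[g0 g1] xb.
have g1' : 1 - g != 0 by rewrite subr_eq0 gt_eqF.
apply: (@ge0_integral_exhaust_le _ _ R lebesgue_measure
  (fun n => [set` `[x + (n.+1%:R)^-1, b]])) => //.
- move=> m n mn; rewrite subsetEset => y/=; rewrite !in_itv/= => /andP[+ ->].
  rewrite andbT; apply: le_trans.
  by rewrite lerD2l lef_pV2 ?posrE ?ltr0n// ler_nat.
- apply/seteqP; split=> [y/=|y [n _]/=]; rewrite !in_itv/= => /andP[xy yb].
    have : 0 < y - x by rewrite subr_gt0.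
    move=> /ltr_add_invr[] n; rewrite add0r => nxy.
    by exists n => //=; rewrite in_itv/= yb andbT -lerBrDl ltW.
  by rewrite yb andbT (lt_le_trans _ xy)// ltrDl invr_gt0 ltr0n.
- by apply/measurable_EFinP; apply: measurable_funTS; exact: measurable_inv_dist_powR.
- move=> n; set c := x + _.
  have xc : x < c by rewrite ltrDl invr_gt0 ltr0n.
  have [cb|bc] := ltP c b; last first.
    rewrite (@integral_Sset1 _ _ _ b) ?lee_fin ?divr_ge0 ?powR_ge0 ?subr_ge0 ?(ltW g1)//.
    move=> y/=; rewrite in_itv/= => /andP[cy yb]; apply/le_anti.
    by rewrite yb (le_trans bc cy).
  under eq_integral.
    move=> y; rewrite inE/= in_itv/= => /andP[cy yb].
    rewrite gtr0_norm ?subr_gt0 ?(lt_le_trans xc)// -powRN. 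
    over.
  have cf y : c <= y <= b -> {for y, continuous (fun z => (z - x) `^ (- g))}.
    move=> /andP[cy yb]; have xy := lt_le_trans xc cy.
    apply/differentiable_continuous/derivable1_diffP.
    by apply: ex_derive; exact: is_derive_powR_shift.
  have dF y : c <= y <= b ->
      is_derive y 1 (fun y => (y - x) `^ (1 - g) / (1 - g)) ((y - x) `^ (- g)).
    move=> /andP[cy yb]; have xy := lt_le_trans xc cy.
    have h := is_derive_powR_shift (1 - g) xy.
    apply: is_derive_eq.
    rewrite !scaler0 add0r; apply: (etrans (mulKf g1' _)).
    by congr (_ `^ _); ring.
  rewrite (FTC2_of_is_derive cb cf dF) lee_fin lerBlDr lerDl.
  by rewrite divr_ge0 ?powR_ge0// subr_ge0 ltW.
Qed.

Lemma integral_powR_left (R : realType) (g x a : R) : 0 < g < 1 -> a < x ->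
  (\int[lebesgue_measure]_(y in `[a, x[) ((`|y - x| `^ g)^-1)%:E
    <= ((x - a) `^ (1 - g) / (1 - g))%:E)%E.
Proof.
move=> /andP[g0 g1] ax.
have g1' : 1 - g != 0 by rewrite subr_eq0 gt_eqF.
apply: (@ge0_integral_exhaust_le _ _ R lebesgue_measure
  (fun n => [set` `[a, x - (n.+1%:R)^-1]])) => //.
- move=> m n mn; rewrite subsetEset => y/=; rewrite !in_itv/= => /andP[-> h].
  apply: (le_trans h).
  by rewrite lerD2l lerN2 lef_pV2 ?posrE ?ltr0n// ler_nat.
- apply/seteqP; split=> [y/=|y [n _]/=]; rewrite !in_itv/= => /andP[ay yx].
    have : 0 < x - y by rewrite subr_gt0.
    move=> /ltr_add_invr[] n; rewrite add0r => nxy.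
    by exists n => //=; rewrite in_itv/= ay/= lerBrDl -lerBrDr ltW.
  by rewrite ay (le_lt_trans yx)// gtrBl invr_gt0 ltr0n.
- by apply/measurable_EFinP; apply: measurable_funTS; exact: measurable_inv_dist_powR.
- move=> n; set c := x - n.+1%:R^-1.
  have cx : c < x by rewrite gtrBl invr_gt0 ltr0n.
  have [ac|ca] := ltP a c; last first.
    rewrite (@integral_Sset1 _ _ _ a) ?lee_fin ?divr_ge0 ?powR_ge0 ?subr_ge0 ?(ltW g1)//.
    move=> y/=; rewrite in_itv/= => /andP[ay yc]; apply/le_anti.
    by rewrite ay (le_trans yc ca).
  under eq_integral.
    move=> y; rewrite inE/= in_itv/= => /andP[ay yc].
    rewrite ltr0_norm ?subr_lt0 ?(le_lt_trans yc)// opprB -powRN.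
    over.
  have cf y : a <= y <= c -> {for y, continuous (fun z => (x - z) `^ (- g))}.
    move=> /andP[ay yc]; have yx := le_lt_trans yc cx.
    apply/differentiable_continuous/derivable1_diffP.
    by apply: ex_derive; exact: is_derive_powR_refl.
  have dF y : a <= y <= c ->
      is_derive y 1 (fun y => - ((x - y) `^ (1 - g) / (1 - g))) ((x - y) `^ (- g)).
    move=> /andP[ay yc]; have yx := le_lt_trans yc cx.
    have h := is_derive_powR_refl (1 - g) yx.
    apply: is_derive_eq.
    rewrite !scaler0 add0r scalerN opprK; apply: (etrans (mulKf g1' _)).
    by congr (_ `^ _); ring.
  rewrite (FTC2_of_is_derive ac cf dF) lee_fin opprK addrC gerBl.
  by rewrite divr_ge0 ?powR_ge0// subr_ge0 ltW.
Qed.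

Lemma integral_powR_tail (R : realType) (s L : R) : 0 < s -> 0 < L ->
  (\int[lebesgue_measure]_(y in `[L, +oo[) (y `^ (- s - 1))%:E
    <= (L `^ (- s) / s)%:E)%E.
Proof.
move=> s0 L0; have sN0 : s != 0 by rewrite gt_eqF.
apply: (@ge0_integral_exhaust_le _ _ R lebesgue_measure
  (fun n => [set` `[L, L + n.+1%:R]])) => //.
- move=> m n mn; rewrite subsetEset => y/=; rewrite !in_itv/= => /andP[-> h].
  by apply: (le_trans h); rewrite lerD2l ler_nat.
- apply/seteqP; split=> [y/=|y [n _]/=]; rewrite !in_itv/= ?andbT; last by case/andP.
  move=> Ly; exists (Num.truncn (y - L)) => //=; rewrite in_itv/= Ly/=.
  by rewrite -lerBlDl ltW// truncnS_gt.
- by apply/measurable_EFinP; apply: measurable_funTS; exact: measurable_powR.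
- by move=> y _; rewrite lee_fin powR_ge0.
- move=> n; set c := L + _.
  have Lc : L < c by rewrite ltrDl ltr0n.
  have cf y : L <= y <= c -> {for y, continuous (fun z => z `^ (- s - 1))}.
    by move=> /andP[Ly _]; apply: powR_continuous_pos; exact: lt_le_trans Ly.
  have dF y : L <= y <= c ->
      is_derive y 1 (fun y => - (y `^ (- s) / s)) (y `^ (- s - 1)).
    move=> /andP[Ly yc]; have y0 := lt_le_trans L0 Ly.
    have h := is_derive1_powR (- s) y0.
    apply: is_derive_eq.
    rewrite !scaler0 add0r mulNr scalerN opprK.
    by apply: (etrans (mulKf sN0 _)).
  rewrite (FTC2_of_is_derive Lc cf dF) lee_fin opprK addrC gerBl.
  by rewrite divr_ge0 ?powR_ge0// ltW.
Qed.

(** * Inequalities for real powers *)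

Lemma powRD_pos (R : realType) (x r s : R) : 0 < x ->
  x `^ (r + s) = x `^ r * x `^ s.
Proof. by move=> x0; rewrite powRD// (gt_eqF x0) implybT. Qed.

Lemma powR_mulr (R : realType) (x s : R) : 0 < x -> x * x `^ s = x `^ (1 + s).
Proof. by move=> x0; rewrite powRD_pos// powRr1// ltW. Qed.

Lemma powR_le (R : realType) (a b s : R) : 0 <= a -> a <= b -> 0 <= s ->
  a `^ s <= b `^ s.
Proof.
move=> a0 ab s0; apply: ge0_ler_powR => //; rewrite nnegrE//.
exact: le_trans ab.
Qed.

Lemma powR_lt (R : realType) (a b s : R) : 0 <= a -> a < b -> 0 < s ->
  a `^ s < b `^ s.
Proof.
move=> a0 ab s0; apply: gt0_ltr_powR => //; rewrite nnegrE//.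
exact: le_trans (ltW ab).
Qed.

Lemma powR_le_neg (R : realType) (a b s : R) : 0 < a -> a <= b -> s <= 0 ->
  b `^ s <= a `^ s.
Proof.
move=> a0 ab s0; rewrite -(opprK s) (powRN b) (powRN a).
have b0 := lt_le_trans a0 ab.
by rewrite lef_pV2 ?posrE ?powR_gt0// powR_le ?oppr_ge0// ltW.
Qed.

Lemma powR_lt_neg (R : realType) (a b s : R) : 0 < a -> a < b -> s < 0 ->
  b `^ s < a `^ s.
Proof.
move=> a0 ab s0; rewrite -(opprK s) (powRN b) (powRN a).
have b0 := lt_trans a0 ab.
by rewrite ltf_pV2 ?posrE ?powR_gt0// powR_lt ?oppr_gt0// ltW.
Qed.

(** Concavity of b^s: the graph lies below its tangent at b. It is Young's
    inequality a^s b^(1-s) <= s a + (1-s) b divided by b^(1-s). *)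
Lemma powR_tangent (R : realType) (a b s : R) : 0 <= a -> a <= b -> 0 < b ->
  0 < s < 1 -> s * b `^ (s - 1) * (b - a) <= b `^ s - a `^ s.
Proof.
move=> a0 ab b0 /andP[s0 s1].
have s1' : 0 < 1 - s by rewrite subr_gt0.
have := @conjugate_powR R (a `^ s) (b `^ (1 - s)) s^-1 (1 - s)^-1
  (powR_ge0 _ _) (powR_ge0 _ _).
rewrite !invr_gt0 !invrK s0 s1' => /(_ erefl erefl).
rewrite addrC subrK => /(_ erefl).
rewrite -!powRrM !mulfV ?gt_eqF// !powRr1 ?(ltW b0)// => h.
have e : b `^ (s - 1) * b `^ (1 - s) = 1.
  by rewrite -powRD_pos// (_ : s - 1 + (1 - s) = 0) ?powRr0//; ring.
have e2 : b `^ (s - 1) * b = b `^ s.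
  by rewrite mulrC powR_mulr//; congr (_ `^ _); ring.
have := ler_wpM2l (powR_ge0 b (s - 1)) h.
rewrite mulrCA e mulr1 mulrDr (mulrA _ b) e2.
nra.
Qed.

(** * The velocity kernel and its action on power weights *)

Definition riesz_kernel (R : realType) (g x y : R) : R :=
  (`|y - x| `^ g)^-1 - (`|x + y| `^ g)^-1.

(** The kernel is nonnegative on the half-line except at y = x, where the
    singular term evaluates to 0; truncation at 0 repairs this null set and
    makes monotonicity of the integral available everywhere. *)
Definition pos_kernel (R : realType) (g x y : R) : R :=
  Num.max (riesz_kernel g x y) 0.

Lemma pos_kernel_ge0 (R : realType) (g x y : R) : 0 <= pos_kernel g x y.
Proof. by rewrite le_max lexx orbT. Qed.

Lemma pos_kernelE (R : realType) (g x y : R) : 0 < g -> 0 < x -> 0 <= y ->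
  y != x -> pos_kernel g x y = riesz_kernel g x y.
Proof.
move=> g0 x0 y0 yx; apply/max_idPl; rewrite subr_ge0.
have xy0 : 0 < x + y by rewrite ltr_wpDr.
have d0 : 0 < `|y - x| by rewrite normr_gt0 subr_eq0.
rewrite (gtr0_norm xy0) lef_pV2 ?posrE ?powR_gt0//.
apply: powR_le; rewrite ?(ltW g0)//.
by rewrite ler_norml; apply/andP; split; lra.
Qed.

Lemma measurable_pos_kernel (R : realType) (g x : R) :
  measurable_fun [set: R] (pos_kernel g x).
Proof.
apply: measurable_maxr => //; apply: measurable_funB.
  exact: measurable_inv_dist_powR.
have := @measurable_inv_dist_powR R g (- x).
by under eq_fun do rewrite opprK addrC.
Qed.

Lemma pos_kernel_le_near (R : realType) (g x y : R) :
  pos_kernel g x y <= (`|y - x| `^ g)^-1.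
Proof.
by rewrite ge_max gerBl !invr_ge0 !powR_ge0.
Qed.

(** The two singular terms cancel to leading order far from x, which gains
    the extra power of y - x that makes weights of exponent less than g
    integrable at infinity. *)
Lemma pos_kernel_le_far (R : realType) (g x y : R) : 0 < g < 1 -> 0 < x ->
  x < y -> pos_kernel g x y <= 2 * x * (y - x) `^ (- g - 1).
Proof.
move=> /andP[g0 g1] x0 xy; set A := y - x.
have A0 : 0 < A by rewrite subr_gt0.
have y0 : 0 < y by exact: lt_trans xy.
rewrite pos_kernelE ?gt_eqF ?(ltW y0)// /riesz_kernel.
rewrite (gtr0_norm A0) (gtr0_norm (addr_gt0 x0 y0)).
rewrite -!powRN; set B := x + y.
have AB : B = A + 2 * x by rewrite /A /B; ring.
have B0 : 0 < B by rewrite AB; lra.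
have eA : A `^ (- g) = A * A `^ (- g - 1).
  by rewrite powR_mulr//; congr (_ `^ _); ring.
have eB : B `^ (- g) = B * B `^ (- g - 1).
  by rewrite powR_mulr//; congr (_ `^ _); ring.
have h : (A * A) * A `^ (- g - 1) <= (B * B) * B `^ (- g - 1).
  rewrite -!mulrA !powR_mulr//; apply: powR_le; lra.
have P0 := powR_gt0 (- g - 1) A0.
rewrite eA lerBlDr -lerBlDl -mulrBl.
rewrite -(ler_pM2l B0) eB; rewrite -(mulrA B B) in h; apply: le_trans h.
by rewrite mulrA ler_pM2r// AB; nra.
Qed.

(** The reverse of the far-field bound, from the tangent inequality for
    b^g between y - x and y + x. *)
Lemma pos_kernel_ge (R : realType) (g x y : R) : 0 < g < 1 -> 0 < x ->
  x < y -> 2 * g * x * (x + y) `^ (- g - 1) <= pos_kernel g x y.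
Proof.
move=> /andP[g0 g1] x0 xy; set A := y - x.
have A0 : 0 < A by rewrite subr_gt0.
have y0 : 0 < y by exact: lt_trans xy.
rewrite pos_kernelE ?gt_eqF ?(ltW y0)// /riesz_kernel.
rewrite (gtr0_norm A0) (gtr0_norm (addr_gt0 x0 y0)).
set B := x + y.
have AB : B = A + 2 * x by rewrite /A /B; ring.
have B0 : 0 < B by rewrite AB; lra.
have := @powR_tangent R A B g (ltW A0) _ B0.
rewrite g0 g1 {1}AB lerDl mulr_ge0 ?(ltW x0)// => /(_ erefl erefl) h.
have e1 : B `^ (- g - 1) = B `^ (g - 1) / (B `^ g * B `^ g).
  rewrite -powRD_pos// -powRN -powRD_pos//; congr (_ `^ _); ring.
have PA := powR_gt0 g A0; have PB := powR_gt0 g B0.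
have -> : (A `^ g)^-1 - (B `^ g)^-1 = (B `^ g - A `^ g) / (A `^ g * B `^ g).
  by field; rewrite !gt_eqF.
have leAB : A `^ g <= B `^ g.
  by apply: powR_le; lra.
apply: (@le_trans _ _ ((B `^ g - A `^ g) / (B `^ g * B `^ g))).
  rewrite e1 mulrA ler_pM2r ?invr_gt0 ?mulr_gt0//.
  by apply: le_trans h; rewrite AB le_eqVlt; apply/orP; left; apply/eqP; ring.
apply: ler_wpM2l; first by rewrite subr_ge0.
by rewrite lef_pV2 ?posrE ?mulr_gt0// ler_pM2r.
Qed.

(** Replacing a weight by its maximum is affordable where the singularity of
    the kernel, and not its decay, determines the integral. *)
Lemma ge0_integral_mul_le (R : realType) (D : set R) (k k' w : R -> R) (c J : R) :
  measurable D ->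
  measurable_fun D k -> measurable_fun D k' -> measurable_fun D w -> 0 <= c ->
  (forall y, D y -> 0 <= k y <= k' y) -> (forall y, D y -> 0 <= w y <= c) ->
  (\int[lebesgue_measure]_(y in D) (k' y)%:E <= J%:E)%E ->
  (\int[lebesgue_measure]_(y in D) (k y * w y)%:E <= (c * J)%:E)%E.
Proof.
move=> mD mk mk' mw c0 kk' wc kJ.
have k'0 y : D y -> 0 <= k' y by move=> /kk'/andP[]; exact: le_trans.
apply: (@le_trans _ _ (\int[lebesgue_measure]_(y in D) (c%:E * (k' y)%:E)))%E.
  apply: ge0_le_integral => //.
  - move=> y Dy; have /andP[? _] := kk' y Dy; have /andP[? _] := wc y Dy.
    by rewrite lee_fin mulr_ge0.
  - by apply/measurable_EFinP; exact: measurable_funM.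
  - by apply/measurable_EFinP; apply: measurable_funM.
  - move=> y Dy; have /andP[? ?] := kk' y Dy; have /andP[? ?] := wc y Dy.
    by rewrite -EFinM lee_fin mulrC ler_pM.
rewrite ge0_integralZl_EFin//.
- by rewrite EFinM; apply: lee_wpmul2l.
- by apply/measurable_EFinP.
Qed.

Lemma measurable_shift_powR (R : realType) (r s : R) (D : set R) : measurable D ->
  measurable_fun D (fun y => (r + y) `^ s).
Proof.
move=> mD; apply: measurable_funTS.
apply: (@measurableT_comp _ _ _ _ _ _ (fun z : R => z `^ s)) => //.
exact: measurable_funD.
Qed.

(** By scaling one expects the bound (r + x)^s (r + x)^(1-g). For y up to
    L = 2(r + x) the weight is at most of the size of its value at x, and the
    integrable singularity contributes L^(1-g); beyond L the far-field decay
    of the kernel is used. As s < g, replacing (r + x)^(s-g) by the larger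
    r^(s-g) leaves a bound linear in r + x whose slope is small for r large. *)
Lemma riesz_kernel_weight_bound (R : realType) (g s : R) :
  0 < g < 1 -> 0 < s < g ->
  exists2 C : R, 0 < C & forall r x : R, 0 < r -> 0 < x ->
    (\int[lebesgue_measure]_(y in `[0%R, +oo[)
      (pos_kernel g x y * (r + y) `^ s)%:E
     <= (C * r `^ (s - g) * (r + x))%:E)%E.
Proof.
move=> /[dup] g01 /andP[g0 g1] /andP[s0 sg].
(* C1 collects the contribution of each side of x up to L, C2 the tail *)
pose C1 : R := 3 `^ s * (2 `^ (1 - g) / (1 - g)).
pose C2 : R := 2 `^ s * (2 * 2 `^ (1 + g) * (2 `^ (s - g) / (g - s))).
have C10 : 0 < C1.
  by rewrite !mulr_gt0 ?invr_gt0 ?powR_gt0 ?subr_gt0.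
have C20 : 0 < C2.
  by rewrite !mulr_gt0 ?invr_gt0 ?powR_gt0 ?subr_gt0.
exists (C1 + C1 + C2); first by rewrite !addr_gt0.
move=> r x r0 x0.
set X := r + x; have X0 : 0 < X by rewrite addr_gt0.
have xX : x < X by rewrite ltrDr.
pose k y := pos_kernel g x y * (r + y) `^ s.
under eq_integral do rewrite -/(k _).
pose L := 2 * X.
have L0 : 0 < L by rewrite mulr_gt0.
have xL : x < L by rewrite /L; lra.
have mk (D : set R) : measurable D -> measurable_fun D (EFin \o k).
  move=> mD; apply/measurable_EFinP; apply: measurable_funM.
    by apply: measurable_funTS; exact: measurable_pos_kernel.
  exact: measurable_shift_powR.
have k0 y : (0 <= (k y)%:E)%E.
  by rewrite lee_fin mulr_ge0 ?pos_kernel_ge0 ?powR_ge0.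
have Xs : X `^ (1 + s - g) <= r `^ (s - g) * X.
  rewrite mulrC (_ : 1 + s - g = 1 + (s - g)); last by ring.
  rewrite -powR_mulr// ler_pM2l// powR_le_neg//; first by rewrite lerDl ltW.
  by rewrite subr_le0 ltW.
have mi (D : set R) : measurable D -> measurable_fun D (fun y => (`|y - x| `^ g)^-1).
  by move=> mD; apply: measurable_funTS; exact: measurable_inv_dist_powR.
have mp (D : set R) : measurable D -> measurable_fun D (pos_kernel g x).
  by move=> mD; apply: measurable_funTS; exact: measurable_pos_kernel.
have w1 y : 0 <= y -> y <= L -> 0 <= (r + y) `^ s <= (3 * X) `^ s.
  move=> y0 yL; rewrite powR_ge0/=; apply: powR_le; rewrite ?(ltW s0)//.
    by rewrite addr_ge0// ltW.
  by rewrite /L /X in yL *; lra.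
have C1E : (3 * X) `^ s * (L `^ (1 - g) / (1 - g)) = C1 * X `^ (1 + s - g).
  rewrite /L !powRM// ?(ltW X0)// (_ : 1 + s - g = s + (1 - g)); last by ring.
  by rewrite powRD_pos// /C1; ring.
have I1 : (\int[lebesgue_measure]_(y in `[0%R, x[) (k y)%:E
    <= (C1 * X `^ (1 + s - g))%:E)%E.
  rewrite -C1E; apply: (@ge0_integral_mul_le _ _ _ (fun y => (`|y - x| `^ g)^-1)) => //;
    [exact: mp|exact: mi|exact: measurable_shift_powR|exact: powR_ge0|..].
  - by move=> y _; rewrite pos_kernel_ge0 pos_kernel_le_near.
  - move=> y/=; rewrite in_itv/= => /andP[y0 yx]; apply: w1 => //.
    by rewrite ltW// (lt_trans yx).
  - apply: (le_trans (integral_powR_left g01 x0)).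
    rewrite lee_fin ler_pM2r ?invr_gt0 ?subr_gt0//; apply: powR_le; lra.
have I2 : (\int[lebesgue_measure]_(y in `]x, L]) (k y)%:E
    <= (C1 * X `^ (1 + s - g))%:E)%E.
  rewrite -C1E; apply: (@ge0_integral_mul_le _ _ _ (fun y => (`|y - x| `^ g)^-1)) => //;
    [exact: mp|exact: mi|exact: measurable_shift_powR|exact: powR_ge0|..].
  - by move=> y _; rewrite pos_kernel_ge0 pos_kernel_le_near.
  - move=> y/=; rewrite in_itv/= => /andP[xy yL]; apply: w1 => //.
    by rewrite ltW// (lt_trans x0).
  - apply: (le_trans (integral_powR_right g01 xL)).
    rewrite lee_fin ler_pM2r ?invr_gt0 ?subr_gt0//; apply: powR_le; lra.
have I3 : (\int[lebesgue_measure]_(y in `]L, +oo[) (k y)%:E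
    <= (C2 * X `^ (1 + s - g))%:E)%E.
  have gs0 : 0 < g - s by rewrite subr_gt0.
  have e : C2 * X `^ (1 + s - g) =
     (2 `^ s * (2 * X * 2 `^ (1 + g))) * (L `^ (- (g - s)) / (g - s)).
    rewrite opprB /L powRM// ?(ltW X0)// -addrA -(powR_mulr _ X0) /C2; ring.
  rewrite e; apply: (@le_trans _ _ (\int[lebesgue_measure]_(y in `]L, +oo[)
     ((y `^ (- (g - s) - 1)) * (2 `^ s * (2 * X * 2 `^ (1 + g))))%:E)%E).
    apply: ge0_le_integral => //.
    - exact: mk.
    - apply/measurable_EFinP; apply: measurable_funM => //.
      by apply: measurable_funTS; exact: measurable_powR.
    - move=> y/=; rewrite in_itv/= andbT => Ly.
      have y0 : 0 < y by exact: lt_trans Ly.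
      have xy : x < y by exact: lt_trans Ly.
      have yx : y / 2 <= y - x by rewrite /L in Ly; lra.
      have h1 : pos_kernel g x y <= 2 * X * (2 `^ (1 + g) * y `^ (- g - 1)).
        apply: (le_trans (pos_kernel_le_far g01 x0 xy)).
        apply: ler_pM; rewrite ?powR_ge0 ?mulr_ge0 ?(ltW x0)//.
          by rewrite ler_pM2l// ltW.
        have <- : (y / 2) `^ (- g - 1) = 2 `^ (1 + g) * y `^ (- g - 1).
          rewrite powRM ?(ltW y0)// mulrC; congr (_ * _).
          by rewrite -(powR_inv1 (ler0n _ 2)) -powRrM; congr (_ `^ _); ring.
        by apply: powR_le_neg => //; [rewrite divr_gt0|lra].
      have h2 : (r + y) `^ s <= 2 `^ s * y `^ s.
        rewrite -powRM ?(ltW y0)//; apply: powR_le; rewrite ?(ltW s0)//.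
          by rewrite addr_ge0 ?ltW.
        by rewrite /L /X in Ly; lra.
      rewrite lee_fin; apply: (le_trans (ler_pM _ _ h1 h2)); rewrite ?pos_kernel_ge0 ?powR_ge0//.
      rewrite (_ : - (g - s) - 1 = (- g - 1) + s); last by ring.
      by rewrite (powRD_pos (- g - 1) s y0) le_eqVlt; apply/orP; left; apply/eqP; ring.
  under eq_integral do rewrite mulrC.
  rewrite integral_itv_obnd_cbnd; last first.
    apply/measurable_EFinP; apply: measurable_funM => //.
    by apply: measurable_funTS; exact: measurable_powR.
  under eq_integral do rewrite EFinM.
  rewrite ge0_integralZl_EFin//.
  - rewrite [leRHS]EFinM; apply: lee_wpmul2l; last exact: integral_powR_tail.
    by rewrite lee_fin !mulr_ge0 ?powR_ge0 ?ltW.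
  - by move=> y _; rewrite lee_fin powR_ge0.
  - by apply/measurable_EFinP; apply: measurable_funTS; exact: measurable_powR.
  - by rewrite !mulr_ge0 ?powR_ge0 ?ltW.
rewrite (@itv_bndbnd_setU _ _ (BLeft 0) (BLeft x) +oo%O); last 2 first.
  - by rewrite bnd_simp ltW.
  - by [].
rewrite ge0_integral_setU//=; last 2 first.
  - by apply: mk; exact: measurableU.
  - apply/disj_setPS => y [/=]; rewrite !in_itv/= => /andP[_ yx] /andP[].
    by rewrite leNgt yx.
rewrite -(@integral_itv_obnd_cbnd _ x); last exact: mk.
rewrite (@itv_bndbnd_setU _ _ (BRight x) (BRight L) +oo%O); last 2 first.
  - by rewrite bnd_simp ltW.
  - by [].
rewrite ge0_integral_setU//=; last 2 first.
  - by apply: mk; exact: measurableU.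
  - apply/disj_setPS => y [/=]; rewrite !in_itv/= => /andP[_ yx].
    by rewrite andbT ltNge yx.
apply: (le_trans (leeD I1 (leeD I2 I3))).
rewrite -!EFinD lee_fin -(mulrA (C1 + C1 + C2)).
apply: (@le_trans _ _ ((C1 + C1 + C2) * X `^ (1 + s - g))).
  by rewrite le_eqVlt; apply/orP; left; apply/eqP; ring.
by rewrite ler_pM2l// !addr_gt0.
Qed.

(** * Estimates of the velocity *)

Section velocity_estimates.
Context {R : realType}.
Implicit Types (f w e : R -> R) (g x : R).
Local Notation mu := (@lebesgue_measure R).
Local Notation D := (`[0, +oo[%classic : set R).

Lemma measurable_pos_kernelM g x f : measurable_fun [set: R] f ->
  measurable_fun D (fun y => pos_kernel g x y * f y).
Proof.
move=> mf; apply: measurable_funTS; apply: measurable_funM => //.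
exact: measurable_pos_kernel.
Qed.

(** Passing to the truncated kernel changes the integrand only at y = x. *)
Lemma velocityE g f x : 0 < g -> 0 < x -> measurable_fun [set: R] f ->
  velocity g f x = - \int[mu]_(y in D) (pos_kernel g x y * f y).
Proof.
move=> g0 x0 mf; congr (- fine _).
have mD : measurable (D `\ x) by apply: measurableD.
have m1 : measurable_fun (D `\ x) (EFin \o (fun y =>
    ((`|y - x| `^ g)^-1 - (`|x + y| `^ g)^-1) * f y)).
  apply/measurable_EFinP; apply: measurable_funTS; apply: measurable_funM => //.
  apply: measurable_funB; first exact: measurable_inv_dist_powR.
  have := @measurable_inv_dist_powR R g (- x).
  by under eq_fun do rewrite opprK addrC.
have m2 : measurable_fun (D `\ x) (EFin \o (fun y => pos_kernel g x y * f y)).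
  apply/measurable_EFinP; apply: measurable_funS (measurable_pos_kernelM g x mf) => //.
rewrite -(integral_setD1 mD m1) -(integral_setD1 mD m2).
apply: eq_integral => y; rewrite inE/= in_itv/= andbT => -[y0 /eqP yx].
by rewrite pos_kernelE.
Qed.

Lemma pos_kernel_integrable g x f w (J : R) :
  measurable_fun [set: R] f -> measurable_fun [set: R] w ->
  (forall y, 0 <= y -> `|f y| <= w y) ->
  (\int[mu]_(y in D) (pos_kernel g x y * w y)%:E <= J%:E)%E ->
  mu.-integrable D (EFin \o (fun y => pos_kernel g x y * f y)).
Proof.
move=> mf mw fw kJ.
have mkw := measurable_pos_kernelM g x mw.
have mkf := measurable_pos_kernelM g x mf.
apply: (@le_integrable _ _ _ mu D _ _ (EFin \o (fun y => pos_kernel g x y * w y))) => //.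
- exact/measurable_EFinP.
- move=> y/=; rewrite in_itv/= andbT => y0; have fwy := fw y y0.
  rewrite lee_fin !normrM ler_wpM2l//.
  by rewrite (ger0_norm (x := w y)) ?(le_trans _ fwy).
- apply/integrableP; split; first exact/measurable_EFinP.
  apply: le_lt_trans (ltry J); apply: le_trans kJ.
  apply: ge0_le_integral => //.
  + by apply/measurableT_comp => //; exact/measurable_EFinP.
  + exact/measurable_EFinP.
  + move=> y/=; rewrite in_itv/= andbT => y0.
    rewrite lee_fin ger0_norm// mulr_ge0 ?pos_kernel_ge0//.
    exact: le_trans (fw y y0).
Qed.

Lemma velocity_norm_le g x f w (J : R) : 0 < g -> 0 < x ->
  measurable_fun [set: R] f -> measurable_fun [set: R] w ->
  (forall y, 0 <= y -> `|f y| <= w y) ->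
  (\int[mu]_(y in D) (pos_kernel g x y * w y)%:E <= J%:E)%E ->
  `|velocity g f x| <= J.
Proof.
move=> g0 x0 mf mw fw kJ; rewrite velocityE// normrN -lee_fin.
have ik := pos_kernel_integrable mf mw fw kJ.
rewrite EFin_normr_Rintegral//.
have mkw := measurable_pos_kernelM g x mw.
have mkf := measurable_pos_kernelM g x mf.
apply: (le_trans (le_abse_integral mu _ _)) => //; first exact/measurable_EFinP.
apply: le_trans kJ; apply: ge0_le_integral => //.
- by apply/measurableT_comp => //; exact/measurable_EFinP.
- exact/measurable_EFinP.
- move=> y/=; rewrite in_itv/= andbT => y0.
  rewrite lee_fin normrM ger0_norm ?pos_kernel_ge0// ler_wpM2l ?pos_kernel_ge0//.
  exact: fw.
Qed.

(** The only upper bound on the velocity that is needed. The function e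
    measures how far f may be from being nonnegative: f + e is discarded
    outside the window ]m, 2m] and bounded below by c on it. The envelope w
    serves solely to split the integral of f. *)
Lemma velocity_le g x f w e (J J' k c m : R) : 0 < g -> 0 < x ->
  0 < m -> 0 <= k -> 0 <= c ->
  measurable_fun [set: R] f -> measurable_fun [set: R] w ->
  measurable_fun [set: R] e ->
  (forall y, 0 <= y -> `|f y| <= w y) -> (forall y, 0 <= y -> 0 <= e y) ->
  (\int[mu]_(y in D) (pos_kernel g x y * w y)%:E <= J'%:E)%E ->
  (\int[mu]_(y in D) (pos_kernel g x y * e y)%:E <= J%:E)%E ->
  (forall y, 0 <= y -> 0 <= f y + e y) ->
  (forall y, m < y <= 2 * m -> c <= f y + e y) ->
  (forall y, m < y <= 2 * m -> k <= pos_kernel g x y) ->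
  velocity g f x <= J - k * c * m.
Proof.
move=> g0 x0 m0 k0 c0 mf mw me fw e0 kJ' kJ fe0 fec kk; rewrite velocityE//.
have ikf := pos_kernel_integrable mf mw fw kJ'.
have ee y : 0 <= y -> `|e y| <= e y by move=> /e0 ey; rewrite ger0_norm.
have ike := pos_kernel_integrable me me ee kJ.
have leJ : \int[mu]_(y in D) (pos_kernel g x y * e y) <= J.
  rewrite -lee_fin fineK//; exact: integrable_fin_num.
have : k * c * m <= \int[mu]_(y in D)
    (pos_kernel g x y * f y + pos_kernel g x y * e y).
  rewrite -lee_fin fineK; last first.
    by apply: integrable_fin_num => //; apply: (integrableD _ ikf ike).
  have sub : `]m, 2 * m]%classic `<=` D.
    move=> y/=; rewrite !in_itv/= andbT => /andP[my _].
    by rewrite ltW// (lt_trans m0).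
  have mm : measurable_fun D
      (EFin \o (fun y => pos_kernel g x y * f y + pos_kernel g x y * e y)).
    apply/measurable_EFinP; apply: measurable_funD; exact: measurable_pos_kernelM.
  apply: (@le_trans _ _ (\int[mu]_(y in `]m, (2 * m)%R])
      (pos_kernel g x y * f y + pos_kernel g x y * e y)%:E)%E); last first.
    apply: ge0_subset_integral => //.
    move=> y/=; rewrite in_itv/= andbT => y0.
    by rewrite lee_fin -mulrDr mulr_ge0 ?pos_kernel_ge0 ?fe0.
  apply: (@le_trans _ _ (\int[mu]_(y in `]m, (2 * m)%R]) (k * c)%:E)%E).
    rewrite integral_cst//= lebesgue_measure_itv/= lte_fin.
    rewrite ltr_pMl// ltr1n -EFinB -EFinM lee_fin.
    by rewrite le_eqVlt; apply/orP; left; apply/eqP; ring.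
  apply: ge0_le_integral => //.
  - by move=> y _; rewrite lee_fin mulr_ge0.
  - exact: measurable_funS mm.
  - move=> y/=; rewrite in_itv/= => my.
    by rewrite lee_fin -mulrDr ler_pM ?kk ?fec.
rewrite RintegralD//; move: leJ; move: (Rintegral _ _ _) (Rintegral _ _ _) => I1 I2.
by clear; lra.
Qed.

End velocity_estimates.

(** * The first-touching principle *)

(** One-sided minimality is what a first contact time provides: nothing is
    known after time t. *)
Lemma derive_le0_of_left_min (R : realType) (f : R -> R) (a t d : R) : a < t ->
  is_derive t 1 f d -> (forall s, a <= s < t -> f t <= f s) -> d <= 0.
Proof.
move=> a_t df fmin; rewrite leNgt; apply/negP => d0.
have cv : h^-1 *: (f (h *: 1 + t) - f t) @[h --> 0^'] --> d.
  have := @ex_derive _ _ _ _ _ _ _ df; rewrite /derivable.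
  by rewrite -[X in _ -> _ --> X](@derive_val _ _ _ _ _ _ _ df).
have /(cvgr_gt d)/(_ 0 d0)[e /= e0 he] := cv.
(* a negative increment - m small enough for the sign and for the minimality *)
pose m := Num.min e (t - a) / 2.
have mm : 0 < Num.min e (t - a) by rewrite lt_min e0 subr_gt0.
have m0 : 0 < m by rewrite divr_gt0.
have me : m < e.
  by rewrite ltr_pdivrMr// (@le_lt_trans _ _ e) ?ge_min ?lexx// ltr_pMr// ltr1n.
have mta : m < t - a.
  rewrite ltr_pdivrMr// (@le_lt_trans _ _ (t - a)) ?ge_min ?lexx ?orbT//.
  by rewrite ltr_pMr ?subr_gt0// ltr1n.
have := he (- m); rewrite /= sub0r opprK gtr0_norm// oppr_eq0 gt_eqF//.
move=> /(_ me erefl); rewrite invrN [_%:A]mulr1 scaleNr oppr_gt0.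
rewrite -[_ *: _]/(_ * _) pmulr_rlt0 ?invr_gt0// subr_lt0 ltNge fmin//.
by apply/andP; split; lra.
Qed.

Lemma is_derive0_of_min (R : realType) (f : R -> R) (x : R) : 0 < x ->
  (forall y, 0 < y -> derivable f y 1) -> (forall y, 0 < y -> f x <= f y) ->
  is_derive x 1 f 0.
Proof.
move=> x0 df fmin.
have x1 : 0 <= x + 1 by rewrite addr_ge0 ?ltW.
apply: (derive1_at_min x1) => [y||y]; rewrite in_itv/=.
- by case/andP=> /df.
- by rewrite x0 ltrDl ltr01.
- by case/andP=> /fmin.
Qed.

(** Projection onto an interval. It turns a function which is continuous on
    a rectangle into one continuous everywhere, so that sublevel sets become
    closed. *)
Definition clip (R : realType) (a b t : R) : R := Num.max a (Num.min b t).

Lemma clip_itv (R : realType) (a b t : R) : a <= b -> a <= clip a b t <= b.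
Proof. by move=> ab; rewrite /clip le_max lexx/= ge_max ab ge_min lexx. Qed.

Lemma clip_id (R : realType) (a b t : R) : a <= t <= b -> clip a b t = t.
Proof. by move=> /andP[at_ tb]; rewrite /clip (min_idPr tb) (max_idPr at_). Qed.

Lemma clip_continuous (R : realType) (a b : R) : continuous (clip a b).
Proof.
move=> t; apply: (@continuous_max _ _ (cst a) (fun t => Num.min b t)).
  exact: cst_continuous.
apply: (@continuous_min _ _ (cst b) id); first exact: cst_continuous.
exact: cvg_id.
Qed.

Lemma within_continuous_clip (R : realType) (h : R -> R -> R) (A : set (R * R))
   (a b L : R) : a <= b -> 0 <= L ->
  (forall t x, a <= t <= b -> 0 <= x -> A (t, x)) ->
  {within A, continuous (fun z => h z.1 z.2)} ->
  continuous (fun z : R * R => h (clip a b z.1) (clip 0 L z.2)).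
Proof.
move=> ab L0 hA /subspace_continuousP hc z.
pose c (z : R * R) := (clip a b z.1, clip 0 L z.2).
have cA z' : A (c z').
  by apply: hA; [exact: clip_itv|have /andP[] := clip_itv z'.2 L0].
have cc : c z' @[z' --> z] --> c z.
  have c1 : clip a b z'.1 @[z' --> z] --> clip a b z.1.
    apply: (@cvg_comp _ _ _ fst (clip a b) _ (nbhs z.1)); first exact: cvg_fst.
    exact: clip_continuous.
  have c2 : clip 0 L z'.2 @[z' --> z] --> clip 0 L z.2.
    apply: (@cvg_comp _ _ _ snd (clip 0 L) _ (nbhs z.2)); first exact: cvg_snd.
    exact: clip_continuous.
  exact: (cvg_pair c1 c2).
apply: (@cvg_comp _ _ _ c (fun z => h z.1 z.2) _ (within A (nbhs (c z)))); last exact: hc.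
move=> P hP; have hz : \forall z' \near z, A (c z') -> P (c z') := cc _ hP.
rewrite /nbhs/=; apply: filterS hz => z'; apply; exact: cA.
Qed.


(** If h starts positive and has ceased to be positive somewhere, then the
    set where h <= 0 is compact (h > 0 for x >= L), and a point (t, x) of it
    with t minimal is an interior spatial minimum with value 0, reached from
    positive values. The time derivative there is then at most 0, which is
    what the last hypothesis excludes. *)
Lemma first_touching (R : realType) (h : R -> R -> R) (a b L : R) :
  a <= b -> 0 <= L ->
  {within [set z : R * R | a <= z.1 <= b /\ 0 <= z.2],
    continuous (fun z => h z.1 z.2)} ->
  (forall x, 0 <= x -> 0 < h a x) ->
  (forall t, a <= t <= b -> 0 < h t 0) ->
  (forall t x, a <= t <= b -> L <= x -> 0 < h t x) ->
  (forall t x, a < t <= b -> 0 < x -> derivable (h t) x 1) ->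
  (forall t x, a < t <= b -> 0 < x -> h t x = 0 ->
    (forall y, 0 <= y -> 0 <= h t y) -> is_derive x 1 (h t) 0 ->
    exists2 d, 0 < d & is_derive t 1 (h^~ x) d) ->
  forall t x, a <= t <= b -> 0 <= x -> 0 < h t x.
Proof.
move=> ab L0 hc ha h0 hL hd touch.
pose H (z : R * R) := h (clip a b z.1) (clip 0 L z.2).
have Hc : continuous H.
  by apply: within_continuous_clip hc => // t x ? ?; split.
have HE t x : a <= t <= b -> 0 <= x <= L -> H (t, x) = h t x.
  by move=> abt xL; rewrite /H/= !clip_id.
pose K := (`[a, b]%classic `*` `[0, L]%classic : set (R * R)).
have cK : compact K by apply: compact_setX; exact: segment_compact.
pose S := K `&` (H @^-1` [set y | y <= 0]).
have cS : compact S.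
  apply: compact_closedI => //; apply: closed_comp; last exact: closed_le.
  by move=> z _; exact: Hc.
have inS t x : a <= t <= b -> 0 <= x -> h t x <= 0 -> S (t, x).
  move=> abt x0 hx.
  have xL : x <= L by rewrite leNgt; apply/negP => /ltW /(hL t x abt); rewrite ltNge hx.
  split; first by split; rewrite /= in_itv//= x0.
  by rewrite /= HE// x0.
move=> t0 x0 abt0 x00; rewrite ltNge; apply/negP => hx0.
have S0 : S !=set0 by exists (t0, x0); exact: inS.
have cfst : {within S, continuous (fst : R * R -> R)}.
  by apply: continuous_subspaceT => z; exact: cvg_fst.
have [[t x]] := compact_EVT_min S0 cS cfst.
rewrite inE => -[[/=]]; rewrite !in_itv/= => abt xL Hx tmin.
have /andP[x_ge0 xleL] := xL.
rewrite HE// in Hx.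
have at_ : a < t.
  case/andP: abt => + _; rewrite le_eqVlt => /predU1P[aE|//].
  by move: Hx; rewrite leNgt -aE ha.
have x_gt0 : 0 < x.
  move: x_ge0; rewrite le_eqVlt => /predU1P[xE|//].
  by move: Hx; rewrite leNgt -xE h0.
have tb : t <= b by case/andP: abt.
have before s y : a <= s < t -> 0 <= y -> 0 < h s y.
  move=> /andP[as_ st] y0; rewrite ltNge; apply/negP => hsy.
  have /tmin/= : (s, y) \in S.
    by rewrite inE; apply: inS => //; rewrite as_ (le_trans (ltW st)).
  by rewrite leNgt st.
have nonneg y : 0 <= y -> 0 <= h t y.
  move=> y0; rewrite leNgt; apply/negP => hty.
  have yL : 0 <= y <= L.
    rewrite y0 leNgt; apply/negP => /ltW /(hL t y abt).
    by rewrite ltNge ltW.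
  have cc : H (s, y) @[s --> t] --> H (t, y).
    apply: (@cvg_comp _ _ _ (fun s => (s, y)) H _ (nbhs (t, y))); last exact: Hc.
    have c1 : s @[s --> t] --> t by exact: cvg_id.
    have c2 : y @[_ --> t] --> y by exact: cvg_cst.
    exact: (cvg_pair c1 c2).
  have /(cvgr_lt (H (t, y)))/(_ 0) := cc; rewrite HE// => /(_ hty)[e /= e0 he].
  pose s := Num.max a (t - e / 2).
  have st : s < t by rewrite gt_max at_ ltrBlDr ltrDl divr_gt0.
  have as_ : a <= s by rewrite le_max lexx.
  have /he/= : `|t - s| < e.
    rewrite gtr0_norm ?subr_gt0// ltrBlDl -ltrBlDr lt_max; apply/orP; right.
    lra.
  rewrite HE// ?as_ ?(le_trans (ltW st))//.
  by rewrite ltNge ltW// before// as_.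
have hx0' : h t x = 0 by apply/le_anti; rewrite Hx nonneg.
have atb : a < t <= b by rewrite at_.
have dx0 : is_derive x 1 (h t) 0.
  apply: is_derive0_of_min => // y y0; first exact: hd.
  by rewrite hx0' nonneg// ltW.
have [d d0 dd] := touch t x atb x_gt0 hx0' nonneg dx0.
have := @derive_le0_of_left_min _ _ _ _ _ at_ dd.
rewrite leNgt d0 => /(_ _)/negP; apply => // s st.
by rewrite hx0' ltW// before.
Qed.

(** * Propagation of growth bounds *)

Lemma is_derive_unique (R : realType) (f : R -> R) (x d1 d2 : R) :
  is_derive x 1 f d1 -> is_derive x 1 f d2 -> d1 = d2.
Proof.
move=> h1 h2.
by rewrite -(@derive_val _ _ _ _ _ _ _ h1) (@derive_val _ _ _ _ _ _ _ h2).
Qed.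

(** Comparing squares handles the bounds v < B and - v < B at once. *)
Lemma is_derive_sqr_sub (R : realType) (B f : R -> R) (x b d : R) :
  is_derive x 1 B b -> is_derive x 1 f d ->
  is_derive x 1 (fun y => B y ^+ 2 - f y ^+ 2) (2 * (B x * b) - 2 * (f x * d)).
Proof.
move=> hB hf; apply: is_derive_eq.
by rewrite /GRing.scale/=; ring.
Qed.

Lemma is_derive_shift_powR (R : realType) (r s x : R) : 0 < r + x ->
  is_derive x 1 (fun z : R => (r + z) `^ s) (s * (r + x) `^ (s - 1)).
Proof.
move=> rx0; have h := is_derive1_powR s rx0.
have g : is_derive x 1 (fun z : R => r + z) (1 : R).
  have := @is_deriveD _ _ _ (cst r) id x 1 0 1 (is_derive_cst r x 1) (is_derive_id x 1).
  by rewrite add0r.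
have := @is_derive1_comp _ (fun z : R => z `^ s) (fun z : R => r + z) _ _ _ h g.
by rewrite mulr1.
Qed.

Lemma riesz_kernel_scaled_bound (R : realType) (g s c x J : R) : 0 <= c ->
  (\int[lebesgue_measure]_(y in `[0%R, +oo[)
      (pos_kernel g x y * (1 + y) `^ s)%:E <= J%:E)%E ->
  (\int[lebesgue_measure]_(y in `[0%R, +oo[)
      (pos_kernel g x y * (c * (1 + y) `^ s))%:E <= (c * J)%:E)%E.
Proof.
move=> c0 hJ; under eq_integral do rewrite mulrCA EFinM.
rewrite ge0_integralZl_EFin//.
- by rewrite EFinM; apply: lee_wpmul2l.
- by move=> y _; rewrite lee_fin mulr_ge0 ?pos_kernel_ge0 ?powR_ge0.
- apply/measurable_EFinP; apply: measurable_pos_kernelM.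
  exact: measurable_shift_powR.
Qed.

Lemma riesz_kernel_weight2_bound (R : realType) (g q r Cq Cr rho x M dl : R) :
  0 < rho -> 0 < x -> 0 <= M -> 0 <= dl ->
  (\int[lebesgue_measure]_(y in `[0%R, +oo[)
      (pos_kernel g x y * (rho + y) `^ q)%:E <= (Cq * rho `^ (q - g) * (rho + x))%:E)%E ->
  (\int[lebesgue_measure]_(y in `[0%R, +oo[)
      (pos_kernel g x y * (rho + y) `^ r)%:E <= (Cr * rho `^ (r - g) * (rho + x))%:E)%E ->
  (\int[lebesgue_measure]_(y in `[0%R, +oo[)
      (pos_kernel g x y * (M * ((rho + y) `^ q + dl * (rho + y) `^ r)))%:E
   <= (M * ((Cq * rho `^ (q - g) + dl * (Cr * rho `^ (r - g))) * (rho + x)))%:E)%E.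
Proof.
move=> rho0 x0 M0 dl0 hq hr.
have mk (s : R) : measurable_fun (`[0%R, +oo[%classic : set R)
    (EFin \o (fun y => pos_kernel g x y * (rho + y) `^ s)).
  apply/measurable_EFinP; apply: measurable_pos_kernelM.
  exact: measurable_shift_powR.
have k0 s y : (0 <= (pos_kernel g x y * (rho + y) `^ s)%:E)%E.
  by rewrite lee_fin mulr_ge0 ?pos_kernel_ge0 ?powR_ge0.
under eq_integral => y _.
  rewrite (_ : _%:E = M%:E * ((pos_kernel g x y * (rho + y) `^ q)%:E +
     dl%:E * (pos_kernel g x y * (rho + y) `^ r)%:E))%E; last first.
    by apply: (congr1 EFin); ring.
  over.
have mdr : measurable_fun (`[0%R, +oo[%classic : set R)
    (fun y => dl%:E * (pos_kernel g x y * (rho + y) `^ r)%:E)%E.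
  by apply: measurable_funeM; exact: mk.
have dr0 y : (0 <= dl%:E * (pos_kernel g x y * (rho + y) `^ r)%:E)%E.
  by rewrite mule_ge0// lee_fin.
rewrite ge0_integralZl_EFin//; last 2 first.
- by move=> y _; rewrite adde_ge0.
- by apply: emeasurable_funD => //; exact: mk.
rewrite EFinM; apply: lee_wpmul2l; first by rewrite lee_fin.
rewrite ge0_integralD//; last exact: mk.
rewrite ge0_integralZl_EFin//; last exact: mk.
rewrite mulrDl EFinD; apply: leeD => //.
by rewrite -mulrA EFinM; apply: lee_wpmul2l => //; rewrite lee_fin.
Qed.

(** A bound by n for the weighted norm of exponent q, without suprema in the
    extended reals. *)
Definition growth_le (R : realType) (q n : R) (f : R -> R) : Prop :=
  forall y, 0 <= y -> `|f y| <= n * (1 + y) `^ q.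

(** What the growth estimates use of a solution on the time interval [a, b].
    The absolute values make the equation insensitive to the direction of
    time. *)
Definition transported (R : realType) (g a b : R) (v : R -> R -> R) : Prop :=
  [/\ {within [set z : R * R | a <= z.1 <= b /\ 0 <= z.2],
        continuous (fun z => v z.1 z.2)},
      forall t, a <= t <= b -> v t 0 = 0,
      forall t x, a <= t <= b -> derivable (v t) x 1 &
      forall t x, a < t <= b -> 0 < x ->
        exists2 d, is_derive t 1 (v^~ x) d &
          `|d| = `|velocity g (v t) x * derive1 (v t) x| ].

Lemma derivable_measurable (R : realType) (f : R -> R) :
  (forall x, derivable f x 1) -> measurable_fun [set: R] f.
Proof.
move=> df; apply: continuous_measurable_fun => x.
by apply/differentiable_continuous/derivable1_diffP.
Qed.

Lemma derivable_is_derive1 (R : realType) (f : R -> R) x :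
  derivable f x 1 -> is_derive x 1 f (derive1 f x).
Proof. by move=> df; rewrite derive1E; exact: DeriveDef. Qed.

(** A positive multiple of the larger power eventually wins. *)
Lemma powR_dominates (R : realType) (q r N e : R) : 0 <= N -> 0 < e -> q < r ->
  exists2 L : R, 0 <= L & forall z, L <= z -> 0 < z -> N * z `^ q < e * z `^ r.
Proof.
move=> N0 e0 qr; have rq0 : 0 < r - q by rewrite subr_gt0.
(* beyond this point z^(r-q) exceeds N / e *)
exists ((N / e + 1) `^ (r - q)^-1); first exact: powR_ge0.
move=> z Lz z0; rewrite (_ : r = q + (r - q)); last by ring.
rewrite (powRD_pos q (r - q) z0).
rewrite mulrCA mulrC ltr_pM2l ?powR_gt0// -ltr_pdivrMl// mulrC.
have Ne : 0 <= N / e by rewrite divr_ge0// ltW.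
apply: (@lt_le_trans _ _ (N / e + 1)); first by rewrite ltrDl.
have -> : N / e + 1 = ((N / e + 1) `^ (r - q)^-1) `^ (r - q).
  by rewrite -powRrM mulVf ?gt_eqF// powRr1// addr_ge0.
by apply: powR_le; rewrite ?powR_ge0// ltW.
Qed.

Lemma within_continuous_sub (R : realType) (A : set (R * R)) (F G : R * R -> R) :
  {within A, continuous F} -> {within A, continuous G} ->
  {within A, continuous (fun z => F z - G z)}.
Proof. by move=> hF hG z; apply: (@cvgB _ _ _ _ _ F G); [exact: hF|exact: hG]. Qed.

Lemma within_continuous_sqr (R : realType) (A : set (R * R)) (F : R * R -> R) :
  {within A, continuous F} -> {within A, continuous (fun z => F z ^+ 2)}.
Proof. by move=> hF z; apply: (@cvgM _ _ _ _ F F); exact: hF. Qed.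

Lemma within_continuous_powR (R : realType) (A : set (R * R)) (F : R * R -> R) (s : R) :
  {within A, continuous F} -> (forall z, A z -> 0 < F z) ->
  {within A, continuous (fun z => F z `^ s)}.
Proof.
move=> /subspace_continuousP cF F0; apply/subspace_continuousP => z Az.
apply: (@cvg_comp _ _ _ F (fun y => y `^ s)); first exact: cF.
by apply: powR_continuous_pos; exact: F0.
Qed.

Lemma within_continuous_envelope (R : realType) (A : set (R * R)) (m : R -> R)
    (rho q r dl : R) : 0 < rho -> continuous m -> (forall z, A z -> 0 <= z.2) ->
  {within A, continuous (fun z => m z.1 * ((rho + z.2) `^ q + dl * (rho + z.2) `^ r))}.
Proof.
move=> rho0 cm A0.
have cs s : {within A, continuous (fun z : R * R => (rho + z.2) `^ s)}.
  apply: within_continuous_powR => [z|z /A0 z0]; last by rewrite ltr_wpDr.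
  have csnd : {within A, continuous (fun z : R * R => z.2)}.
    by apply: continuous_subspaceT => z'; exact: cvg_snd.
  by apply: cvgD; [exact: cvg_cst|exact: csnd].
have cm1 : {within A, continuous (fun z : R * R => m z.1)}.
  apply: continuous_subspaceT => z.
  by apply: (@continuous_comp _ _ _ fst m); [exact: cvg_fst|exact: cm].
move=> z; apply: (@cvgM _ _ _ _ (fun z : R * R => m z.1)
   (fun z => (rho + z.2) `^ q + dl * (rho + z.2) `^ r)); first exact: cm1.
apply: (@cvgD _ _ _ _ _ (fun z : R * R => (rho + z.2) `^ q)); first exact: cs.
apply: (@cvgM _ _ _ _ (fun z : R * R => dl)); first exact: cvg_cst.
exact: cs.
Qed.

(** The squared envelope minus the squared solution cannot vanish for the
    first time. At a first contact both have the same slope, so the solution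
    grows at most at the rate |u| B_x, where B = M(t) W(x) is the envelope,
    and |u| is controlled by the envelope itself: u is at most a constant
    times M rho^(r-g) (rho + x). Since (rho + x) W' <= W, the linear growth
    of M from n to 2n over the time D beats this as soon as rho^(g-r) exceeds
    a constant times D n. The small multiple dl of the larger power r is
    there to keep the contact away from infinity; the constant does not
    depend on it, nor on the qualitative bound N1. *)
Lemma growth_envelope (R : realType) (g q r : R) :
  0 < g < 1 -> 0 < q < r -> r < g ->
  exists2 C : R, 0 < C & forall (v : R -> R -> R) (a b n D rho dl : R),
    a <= b -> b - a <= D -> 0 < D -> 0 < n -> 1 <= rho -> 0 < dl <= 1 ->
    C * D * n < rho `^ (g - r) ->
    transported g a b v ->
    (exists2 N1, 0 <= N1 & forall t, a <= t <= b -> growth_le q N1 (v t)) ->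
    growth_le q n (v a) ->
    forall t x, a <= t <= b -> 0 <= x ->
      `|v t x| <= 2 * n * ((rho + x) `^ q + dl * (rho + x) `^ r).
Proof.
move=> g01 /andP[q0 qr] rg; have /andP[g0 g1] := g01.
have r0 : 0 < r := lt_trans q0 qr.
have r1 : r < 1 := lt_trans rg g1.
have [|Cq Cq0 hCq] := @riesz_kernel_weight_bound R g q g01.
  by rewrite q0 (lt_trans qr).
have [|Cr Cr0 hCr] := @riesz_kernel_weight_bound R g r g01; first by rewrite r0.
exists (4 * (Cq + Cr)); first by rewrite mulr_gt0// addr_gt0.
move=> v a b n D rho dl ab baD D0 n0 rho1 /andP[dl0 dl1] rhoC [vc v00 vdx vdt]
  [N1 N10 vN1] van.
have rho0 : 0 < rho by exact: lt_le_trans rho1.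
pose W (x : R) := (rho + x) `^ q + dl * (rho + x) `^ r.
pose W' (x : R) := q * (rho + x) `^ (q - 1) + dl * (r * (rho + x) `^ (r - 1)).
pose M (t : R) := n * (1 + (t - a) / D).
have M1 t : a <= t <= b -> n <= M t <= 2 * n.
  move=> /andP[at_ tb]; rewrite /M ler_peMr ?(ltW n0)//=; last first.
    by rewrite lerDl divr_ge0 ?subr_ge0// ltW.
  rewrite mulrC ler_pM2r// -lerBrDl (_ : 2 - 1 = 1) ?ler_pdivrMr ?mul1r//; last by ring.
  by apply: le_trans baD; rewrite lerD2r.
have W0 x : 0 <= x -> 0 < W x.
  by move=> x0; rewrite addr_gt0// ?mulr_gt0// powR_gt0 ?ltr_wpDr.
have W'0 x : 0 <= x -> 0 <= W' x.
  by move=> x0; rewrite addr_ge0// !mulr_ge0 ?powR_ge0// ltW.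
have W'W x : 0 <= x -> (rho + x) * W' x <= W x.
  move=> x0; have rx0 : 0 < rho + x by rewrite ltr_wpDr.
  have e s : (rho + x) * (rho + x) `^ (s - 1) = (rho + x) `^ s.
    by rewrite powR_mulr//; congr (_ `^ _); ring.
  have Pq := powR_ge0 (rho + x) q; have Pr := powR_ge0 (rho + x) r.
  have -> : (rho + x) * W' x =
      q * ((rho + x) * (rho + x) `^ (q - 1)) +
      dl * (r * ((rho + x) * (rho + x) `^ (r - 1))) by rewrite /W'; ring.
  rewrite !e /W; apply: lerD; first by rewrite ler_piMl// ltW// (lt_trans qr).
  by rewrite ler_pM2l// ler_piMl// ltW.
have dW (x : R) : 0 <= x -> is_derive x 1 W (W' x).
  move=> x0; have rx0 : 0 < rho + x by rewrite ltr_wpDr.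
  have h1 := is_derive_shift_powR q rx0; have h2 := is_derive_shift_powR r rx0.
  by apply: is_derive_eq.
have dM (t : R) : is_derive t 1 M (n / D).
  have h1 : is_derive t 1 (fun s : R => s - a) 1.
    by apply: is_derive_eq; rewrite ?subr0.
  apply: is_derive_eq.
  by rewrite !scaler0 !add0r; rewrite /GRing.scale/=; ring.
pose h (t x : R) := (M t * W x) ^+ 2 - (v t x) ^+ 2.
suff hpos t x : a <= t <= b -> 0 <= x -> 0 < h t x.
  move=> t x abt x0; have := hpos t x abt x0; rewrite subr_gt0 => hh.
  have /andP[nM M2n] := M1 t abt.
  apply: (@le_trans _ _ (M t * W x)); last by rewrite ler_pM2r ?W0.
  have MW0 : 0 <= M t * W x by rewrite mulr_ge0 ?(ltW (W0 x x0))// (le_trans _ nM)// ltW.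
  by rewrite ltW// -(@ltr_pXn2r _ 2) ?nnegrE ?normr_ge0// real_normK ?num_real.
have [|L L0 hL] := @powR_dominates R q r N1 (n * dl) N10 _ qr; first by rewrite mulr_gt0.
have MW_pos s y : a <= s <= b -> 0 <= y -> 0 < M s * W y.
  move=> /M1/andP[nM _] y0; rewrite mulr_gt0 ?W0//; exact: lt_le_trans nM.
have hgt s y : a <= s <= b -> 0 <= y -> `|v s y| < M s * W y -> 0 < h s y.
  move=> abs y0 vMW; rewrite subr_gt0 -[ltLHS]real_normK ?num_real//.
  by rewrite ltr_pXn2r ?nnegrE ?normr_ge0// ltW// MW_pos.
apply: (@first_touching _ h a b L ab L0).
- apply: within_continuous_sub; apply: within_continuous_sqr => //.
  apply: within_continuous_envelope => //; last by move=> z [].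
  by move=> s; apply/differentiable_continuous/derivable1_diffP; exact: ex_derive.
- move=> y y0; apply: hgt; rewrite ?lexx//.
  have /andP[nM _] := M1 a (introT andP (conj (lexx a) ab)).
  apply: (le_lt_trans (van y y0)); apply: (@lt_le_trans _ _ (n * W y)); last first.
    by rewrite ler_pM2r// W0.
  rewrite ltr_pM2l// (@le_lt_trans _ _ ((rho + y) `^ q))//.
    by apply: powR_le; rewrite ?(ltW q0)// ?addr_ge0// lerD2r.
  by rewrite ltrDl mulr_gt0// powR_gt0 ?ltr_wpDr.
- by move=> s abs; apply: hgt; rewrite // v00// normr0 MW_pos.
- move=> s y abs Ly; have y0 : 0 <= y by exact: le_trans Ly.
  have /andP[nM _] := M1 s abs.
  apply: hgt => //; apply: (le_lt_trans (vN1 s abs y y0)).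
  apply: (@lt_le_trans _ _ (n * W y)); last by rewrite ler_pM2r// W0.
  apply: (@le_lt_trans _ _ (N1 * (rho + y) `^ q)).
    by apply: ler_wpM2l => //; apply: powR_le; rewrite ?(ltW q0)// ?addr_ge0// lerD2r.
  apply: (@lt_le_trans _ _ (n * dl * (rho + y) `^ r)).
    by apply: hL; rewrite ?ltr_wpDr// (le_trans Ly)// lerDr ltW.
  by rewrite -mulrA ler_pM2l// lerDr powR_ge0.
- move=> s y /andP[as_ sb] y0; have abs : a <= s <= b by rewrite ltW.
  have h2 : is_derive y 1 (fun z => M s * W z) (M s * W' y).
    exact: @is_deriveZ _ _ _ W (M s) y 1 _ (dW y (ltW y0)).
  have h3 := derivable_is_derive1 (vdx s y abs).
  exact: (@ex_derive _ _ _ _ _ _ _ (is_derive_sqr_sub h2 h3)).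
move=> s y asb y0 hsy hge dh0; have y0' := ltW y0.
have abs : a <= s <= b by move: asb => /andP[/ltW -> ->].
have /andP[nM M2n] := M1 s abs.
have Ms0 : 0 < M s by exact: lt_le_trans nM.
have Wy0 := W0 y y0'; have W'y0 := W'0 y y0'.
have MW0 := MW_pos s y abs y0'.
set vx := derive1 (v s) y.
have dvx : is_derive y 1 (v s) vx by exact: derivable_is_derive1 (vdx s y abs).
(* at the contact point the two squares have the same slope *)
have slope : v s y * vx = M s * W y * (M s * W' y).
  have h2 : is_derive y 1 (fun z => M s * W z) (M s * W' y).
    exact: @is_deriveZ _ _ _ W (M s) y 1 _ (dW y y0').
  have := is_derive_unique (is_derive_sqr_sub h2 dvx) dh0.
  by clear; lra.
have [d dd du] := vdt s y asb y0.
have vle z : 0 <= z -> `|v s z| <= M s * W z.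
  move=> z0; have MWz := ltW (MW_pos s z abs z0).
  rewrite -(@ler_pXn2r _ 2) ?nnegrE ?normr_ge0// real_normK ?num_real//.
  by rewrite -subr_ge0; exact: hge.
have mW : measurable_fun [set: R] (fun z => M s * W z).
  apply: measurable_funM => //; apply: measurable_funD; first exact: measurable_shift_powR.
  by apply: measurable_funM => //; exact: measurable_shift_powR.
have mv : measurable_fun [set: R] (v s).
  by apply: derivable_measurable => z; exact: vdx.
have ub := velocity_norm_le g0 y0 mv mW vle
  (riesz_kernel_weight2_bound rho0 y0 (ltW Ms0) (ltW dl0)
    (hCq rho y rho0 y0) (hCr rho y rho0 y0)).
set u := velocity g (v s) y in ub du.
have dh : is_derive s 1 (h^~ y)
    (2 * (M s * W y * (n / D * W y)) - 2 * (v s y * d)).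
  have h1 : is_derive s 1 (fun z => M z * W y) (n / D * W y).
    have hM := dM s; apply: is_derive_eq.
    by rewrite scaler0 add0r [_ *: _]mulrC.
  exact: is_derive_sqr_sub h1 dd.
exists (2 * (M s * W y * (n / D * W y)) - 2 * (v s y * d)) => //.
rewrite subr_gt0 ltr_pM2l//; apply: (le_lt_trans (ler_norm _)).
rewrite normrM du normrM mulrCA -normrM slope (ger0_norm (mulr_ge0 _ _)); last 2 first.
- exact: ltW.
- by rewrite mulr_ge0// ltW.
rewrite mulrCA ltr_pM2l//.
(* the envelope outruns the velocity because rho is large *)
have Krho : (Cq * rho `^ (q - g) + dl * (Cr * rho `^ (r - g))) <= (Cq + Cr) * rho `^ (r - g).
  have Pr := powR_ge0 rho (r - g).
  rewrite mulrDl; apply: lerD.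
    by rewrite ler_pM2l//; apply: ler_powR => //; rewrite lerD2r ltW.
  by rewrite ler_piMl// mulr_ge0// ltW.
have uW' : `|u| * (M s * W' y) <= (2 * n) ^+ 2 * ((Cq + Cr) * rho `^ (r - g)) * W y.
  apply: (@le_trans _ _ (M s * (((Cq + Cr) * rho `^ (r - g)) * (rho + y)) * (M s * W' y))).
    apply: ler_wpM2r; first by rewrite mulr_ge0// ltW.
    apply: (le_trans ub); rewrite ler_pM2l// ler_wpM2r//.
    by rewrite addr_ge0// ltW.
  have -> : M s * ((Cq + Cr) * rho `^ (r - g) * (rho + y)) * (M s * W' y) =
     M s ^+ 2 * ((Cq + Cr) * rho `^ (r - g)) * ((rho + y) * W' y) by ring.
  have KK : 0 <= (Cq + Cr) * rho `^ (r - g) by rewrite mulr_ge0 ?powR_ge0// addr_ge0// ltW.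
  apply: ler_pM; last exact: W'W.
  - by rewrite mulr_ge0 ?sqr_ge0.
  - by rewrite mulr_ge0// addr_ge0// ltW.
  apply: ler_wpM2r => //; rewrite ler_pXn2r ?nnegrE ?(ltW Ms0)//.
  by rewrite mulr_ge0// ltW.
apply: (le_lt_trans uW'); rewrite ltr_pM2r//.
have e : rho `^ (g - r) * rho `^ (r - g) = 1.
  by rewrite -powRD_pos// (_ : g - r + (r - g) = 0) ?powRr0//; ring.
have P0 := powR_gt0 (r - g) rho0.
rewrite ltr_pdivlMr//.
have := rhoC; rewrite -(ltr_pM2r P0) e -(ltr_pM2r n0) mul1r; apply: le_lt_trans.
by rewrite le_eqVlt; apply/orP; left; apply/eqP; ring.
Qed.

(** * A Baire category argument for bounds that propagate *)

(** Think of P n t as: the norm at time t is at most n. The hypotheses are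
    monotonicity, finiteness, lower semicontinuity, and propagation of bounds
    from the left and from the right on intervals where some bound is known.
    An interval is good when it has a uniform bound. A bad interval contains,
    for each m, a bad subinterval on which the norm exceeds m; a point common
    to a nested sequence of these would have infinite norm. *)
Lemma uniform_of_propagation (R : realType) (P : R -> R -> Prop) (a b : R) :
  (forall n m t, n <= m -> P n t -> P m t) ->
  (forall t, a <= t <= b -> exists n, P n t) ->
  (forall n t, a <= t <= b ->
    (forall e, 0 < e -> exists2 s, a <= s <= b & `|t - s| < e /\ P n s) -> P n t) ->
  (forall n, 0 < n -> exists N, forall c d, a <= c -> c <= d -> d <= b ->
    (exists N1, forall t, c <= t <= d -> P N1 t) -> P n c ->
    forall t, c <= t <= d -> P N t) ->
  (forall n, 0 < n -> exists N, forall c d, a < c -> c <= d -> d <= b ->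
    (exists N1, forall t, c <= t <= d -> P N1 t) -> P n d ->
    forall t, c <= t <= d -> P N t) ->
  a <= b -> exists N, forall t, a <= t <= b -> P N t.
Proof.
move=> Pmono Pfin Pclosed Pfwd Pbwd ab.
pose good c d := exists N, forall t, c <= t <= d -> P N t.
apply: contrapT => bad_ab.
have step c d m : a <= c -> c <= d -> d <= b -> ~ good c d ->
    exists cd : R * R, [/\ c <= cd.1, cd.1 <= cd.2, cd.2 <= d, ~ good cd.1 cd.2
      & forall t, cd.1 <= t <= cd.2 -> ~ P m t].
  move=> ac cd db bad; apply: contrapT => nstep; apply: bad.
  have hgood c' d' : c <= c' -> c' <= d' -> d' <= d ->
      (forall t, c' <= t <= d' -> ~ P m t) -> good c' d'.
    move=> cc' cd' dd' nP; apply: contrapT => bad'.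
    by apply: nstep; exists (c', d').
  have [nc Pnc] : exists n, P n c by apply: Pfin; rewrite ac (le_trans cd).
  pose n := Num.max m (Num.max nc 1).
  have n0 : 0 < n by rewrite !lt_max ltr01 !orbT.
  have Pn_c : P n c by apply: Pmono Pnc; rewrite !le_max lexx orbT.
  have [N hN] := Pfwd n n0.
  exists (Num.max N n) => t /andP[ct td].
  have [Pnt|nPnt] := pselect (P n t).
    by apply: Pmono Pnt; rewrite le_max lexx orbT.
  (* the last time before t at which the norm is at most n *)
  pose S := [set s | c <= s <= t /\ P n s].
  have Sc : S c by split => //; rewrite lexx.
  have supS : has_sup S.
    by split; [exists c|exists t => s [/andP[]]].
  pose s0 := sup S.
  have cs0 : c <= s0 by apply: ub_le_sup => //; case: supS.
  have s0t : s0 <= t by apply: ge_sup; [exists c|move=> s [/andP[]]].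
  have as0 : a <= s0 by exact: le_trans cs0.
  have tb : t <= b by exact: le_trans db.
  have Pns0 : P n s0.
    apply: Pclosed; first by rewrite as0 (le_trans s0t).
    move=> e e0; have [s [/andP[cs st] Ps] hs] := sup_adherent e0 supS.
    exists s; first by rewrite (le_trans ac) ?(le_trans st).
    split => //; have ss0 : s <= s0.
      by apply: ub_le_sup; [case: supS|split => //; rewrite cs].
    by rewrite ger0_norm ?subr_ge0// ltrBlDl -ltrBlDr.
  have nPs r : s0 < r -> r <= t -> ~ P n r.
    move=> s0r rt Pr; have := s0r; rewrite ltNge => /negP; apply.
    apply: ub_le_sup; first by case: supS.
    by split => //; rewrite rt (le_trans cs0)// ltW.
  have s0lt : s0 < t.
    by rewrite lt_neqAle s0t andbT; apply/eqP => s0E; rewrite s0E in Pns0.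
  have [nt Pnt] : exists k, P k t by apply: Pfin; rewrite (le_trans ac).
  pose nt' := Num.max nt 1.
  have [N' hN'] := Pbwd nt' ltac:(by rewrite lt_max ltr01 orbT).
  have Pnt' : P nt' t by apply: Pmono Pnt; rewrite le_max lexx.
  have PN' r : s0 < r -> r <= t -> P N' r.
    move=> s0r rt; apply: (hN' r t) => //; last by rewrite lexx.
      exact: le_lt_trans s0r.
    apply: hgood => //; first by rewrite (le_trans cs0)// ltW.
    move=> z /andP[rz zt] Pz; apply: (nPs z) => //; first exact: lt_le_trans rz.
    by apply: Pmono Pz; rewrite le_max lexx.
  have PN : P N t.
    apply: (hN s0 t) => //; last by rewrite s0t lexx.
    exists (Num.max N' n) => r /andP[]; rewrite le_eqVlt => /predU1P[<- _|s0r rt].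
      by apply: Pmono Pns0; rewrite le_max lexx orbT.
    by apply: Pmono (PN' r s0r rt); rewrite le_max lexx.
  by apply: Pmono PN; rewrite le_max lexx.
pose inv (x : R * R) := [/\ a <= x.1, x.1 <= x.2, x.2 <= b & ~ good x.1 x.2].
have /choice[F hF] : forall xm : (R * R) * nat, exists y : R * R, inv xm.1 ->
    [/\ xm.1.1 <= y.1, y.2 <= xm.1.2, inv y
      & forall t, y.1 <= t <= y.2 -> ~ P xm.2%:R t].
  move=> [[c d] m] /=; have [[/= ac cd db bad]|ninv] := pselect (inv (c, d)).
    have [[c' d']/= [cc' cd' dd' bad' nP]] := step c d m%:R ac cd db bad.
    exists (c', d') => _; split => //.
    by split => //=; [exact: le_trans cc'|exact: le_trans db].
  by exists (c, d).
(* the m-th step avoids the times at which the norm is at most m *)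
pose u := fix u k := if k is k'.+1 then F (u k', k') else (a, b).
have uinv k : inv (u k).
  elim: k => [|k IH]; first by split => //=.
  by have [] := hF (u k, k) IH.
have uS k : [/\ (u k).1 <= (u k.+1).1, (u k.+1).2 <= (u k).2
    & forall t, (u k.+1).1 <= t <= (u k.+1).2 -> ~ P k%:R t].
  by have [] := hF (u k, k) (uinv k).
have u1 j k : (j <= k)%N -> (u j).1 <= (u k).1.
  move=> /subnKC <-; elim: (k - j)%N => [|i IH]; first by rewrite addn0.
  by rewrite addnS (le_trans IH)//; have [] := uS (j + i)%N.
have u2 j k : (j <= k)%N -> (u k).2 <= (u j).2.
  move=> /subnKC <-; elim: (k - j)%N => [|i IH]; first by rewrite addn0.
  by rewrite addnS; apply: le_trans IH; have [] := uS (j + i)%N.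
have u12 j k : (u j).1 <= (u k).2.
  have [_ h _ _] := uinv (maxn j k).
  by rewrite (le_trans (u1 _ _ (leq_maxl j k)))// (le_trans h)// u2// leq_maxr.
pose S := range (fun k => (u k).1).
have supS : has_sup S.
  by split; [exists a, 0%N|exists b => _ [k _ <-]; exact: (u12 k 0%N)].
pose z := sup S.
have z1 k : (u k).1 <= z by apply: ub_le_sup; [case: supS|exists k].
have z2 k : z <= (u k).2 by apply: ge_sup; [case: supS|move=> _ [j _ <-]].
have [n Pn] : exists n, P n z.
  by apply: Pfin; rewrite (z1 0%N) (z2 0%N).
have [_ _ nP] := uS (Num.truncn n).+1.
apply: (nP z); first by rewrite z1 z2.
by apply: Pmono Pn; rewrite ltW// (lt_le_trans (truncnS_gt n)).
Qed.

(** * Growth bounds for smooth solutions, uniform in time *)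

(** Choose rho as large as [growth_envelope] requires for the given n and D,
    and let dl tend to 0. The resulting N depends on neither v nor the
    interval nor the qualitative bound. *)
Lemma growth_propagation (R : realType) (g q n D : R) :
  0 < g < 1 -> 0 < q < g -> 0 < n -> 0 < D ->
  exists N : R, forall (v : R -> R -> R) (a b : R),
    a <= b -> b - a <= D -> transported g a b v ->
    (exists N1, forall t, a <= t <= b -> growth_le q N1 (v t)) ->
    growth_le q n (v a) ->
    forall t, a <= t <= b -> growth_le q N (v t).
Proof.
move=> g01 /andP[q0 qg] n0 D0.
pose r := (q + g) / 2.
have qr : q < r by rewrite /r; lra.
have rg : r < g by rewrite /r; lra.
have [|C C0 hC] := @growth_envelope R g q r g01 _ rg; first by rewrite q0.
have gr0 : 0 < g - r by rewrite subr_gt0.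
have K0 : 0 <= C * D * n by rewrite !mulr_ge0// ltW.
(* chosen so that rho^(g-r) = C D n + 1 *)
pose rho := (C * D * n + 1) `^ (g - r)^-1.
have rho1 : 1 <= rho.
  apply: (@le_trans _ _ (1 `^ (g - r)^-1)); first by rewrite powR1.
  by apply: powR_le; rewrite ?ler01 ?lerDr// invr_ge0 ltW.
have rho0 : 0 < rho by exact: lt_le_trans rho1.
have rhoE : C * D * n < rho `^ (g - r).
  by rewrite -powRrM mulVf ?gt_eqF// powRr1 ?addr_ge0// ltrDl.
exists (2 * n * rho `^ q) => v a b ab baD tr [N1 hN1] van t abt x x0.
have N1' : exists2 N1, 0 <= N1 & forall t, a <= t <= b -> growth_le q N1 (v t).
  exists (Num.max N1 0); first by rewrite le_max lexx orbT.
  move=> s abs y y0; apply: (le_trans (hN1 s abs y y0)).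
  by rewrite ler_wpM2r ?powR_ge0// le_max lexx.
apply: (@le_trans _ _ (2 * n * (rho + x) `^ q)); last first.
  rewrite -[leRHS]mulrA ler_pM2l ?mulr_gt0// -powRM ?(ltW rho0) ?addr_ge0//.
  apply: powR_le; rewrite ?(ltW q0) ?addr_ge0 ?(ltW rho0)//.
  by rewrite mulrDr mulr1 lerD2l ler_peMl.
apply/ler_addgt0Pr => e e0.
have rx0 : 0 < rho + x by rewrite ltr_wpDr.
have P0 : 0 < 2 * n * (rho + x) `^ r by rewrite !mulr_gt0// powR_gt0.
pose dl := Num.min 1 (e / (2 * n * (rho + x) `^ r)).
have dl01 : 0 < dl <= 1 by rewrite lt_min ltr01 divr_gt0//= ge_min lexx.
have := hC v a b n D rho dl ab baD D0 n0 rho1 dl01 rhoE tr N1' van t x abt x0.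
move/le_trans; apply; rewrite mulrDr lerD2l mulrCA -ler_pdivlMr//.
by rewrite ge_min lexx orbT.
Qed.

Lemma wnorm_ge0 (R : realType) (s : R) (f : R -> R) : (0 <= wnorm s f)%E.
Proof.
apply: (@le_trans _ _ (`|f 0| * (1 + 0) `^ (- s))%:E).
  by rewrite lee_fin mulr_ge0 ?powR_ge0.
by apply: ereal_sup_ubound; exists 0 => //=.
Qed.

Lemma wnorm_growth_le (R : realType) (s : R) (f : R -> R) : (wnorm s f < +oo)%E ->
  exists n, growth_le s n f.
Proof.
move=> fin; have fn : wnorm s f \is a fin_num by rewrite ge0_fin_numE ?wnorm_ge0.
exists (fine (wnorm s f)) => x x0; have x1 : 0 < 1 + x by rewrite ltr_wpDr.
rewrite -ler_pdivrMr ?powR_gt0// -powRN -lee_fin fineK//.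
by apply: ereal_sup_ubound; exists x.
Qed.

Lemma wnorm_pair_growth_le (R : realType) (s s' : R) (f f' : R -> R) :
  (wnorm s f + wnorm s' f' < +oo)%E -> exists n, growth_le s n f.
Proof.
move=> h; apply: wnorm_growth_le; apply: le_lt_trans h.
by rewrite leeDl// wnorm_ge0.
Qed.

Lemma within_continuous_comp (R : realType) (A B : set (R * R)) (F : R * R -> R)
    (phi : R * R -> R * R) : continuous phi -> (forall z, B z -> A (phi z)) ->
  {within A, continuous F} -> {within B, continuous (F \o phi)}.
Proof.
move=> cphi BA /subspace_continuousP cF; apply/subspace_continuousP => z Bz.
apply: (@cvg_comp _ _ _ phi F _ (within A (nbhs (phi z)))); last by apply: cF; exact: BA.
move=> P hP.
have hz : \forall z' \near z, A (phi z') -> P (phi z') := cphi z _ hP.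
by rewrite /within/= /nbhs/=; apply: filterS hz => z' h /BA.
Qed.

Lemma smooth_transported (R : realType) (g q : R) (T : \bar R) (w : R -> R -> R)
    (a b : R) : smooth_solution g q T w -> 0 <= a -> (b%:E < T)%E ->
  transported g a b w.
Proof.
move=> [_ wodd [wdx wdt wc _ _] _ weq] a0 bT.
have inT t : t <= b -> (t%:E < T)%E by move=> tb; apply: le_lt_trans bT; rewrite lee_fin.
split.
- apply: continuous_subspaceW wc => z [/andP[az zb] _] /=.
  by rewrite (le_trans a0)//; split => //; exact: inT.
- move=> t /andP[at_ tb]; have := wodd t (le_trans a0 at_) (inT t tb) 0.
  by rewrite oppr0; lra.
- by move=> t x /andP[at_ tb]; apply: wdx; [exact: le_trans at_|exact: inT].
- move=> t x /andP[at_ tb] x0; have t0 : 0 < t by exact: le_lt_trans at_.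
  exists (dt w t x).
    by apply: derivable_is_derive1; apply: wdt => //; exact: inT.
  have /eqP := weq t x t0 (inT t tb).
  by rewrite addr_eq0 => /eqP ->; rewrite normrN.
Qed.

(** Reversal of time flips only the sign of the time derivative. The
    interval stays away from 0, since the equation is two-sided in time only
    at positive times. *)
Lemma smooth_transported_rev (R : realType) (g q : R) (T : \bar R) (w : R -> R -> R)
    (a b : R) : smooth_solution g q T w -> 0 < a -> (b%:E < T)%E ->
  transported g a b (fun t => w (a + b - t)).
Proof.
move=> [_ wodd [wdx wdt wc _ _] _ weq] a0 bT.
have inT t : t <= b -> (t%:E < T)%E by move=> tb; apply: le_lt_trans bT; rewrite lee_fin.
have rv t : a <= t <= b -> 0 < a + b - t /\ ((a + b - t)%:E < T)%E.
  by move=> /andP[at_ tb]; split; [lra|apply: inT; lra].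
split.
- apply: (@within_continuous_comp _ _ _ (fun z => w z.1 z.2)
    (fun z => (a + b - z.1, z.2))) wc => [z|z [/rv[z0 zT] _] /=]; last by rewrite ltW.
  have c1 : (a + b - z'.1) @[z' --> z] --> a + b - z.1.
    by apply: cvgB; [exact: cvg_cst|exact: cvg_fst].
  have c2 : z'.2 @[z' --> z] --> z.2 by exact: cvg_snd.
  exact: (cvg_pair c1 c2).
- move=> t /rv[t0 tT]; have := wodd _ (ltW t0) tT 0.
  by rewrite oppr0; lra.
- by move=> t x /rv[t0 tT]; apply: wdx => //; exact: ltW.
- move=> t x /andP[at_ tb] x0; have [|s0 sT] := rv t; first by rewrite ltW.
  exists (- dt w (a + b - t) x).
    have h := derivable_is_derive1 (wdt _ x s0 sT).
    have k : is_derive t 1 (fun s : R => a + b - s) (- 1 : R).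
      have := @is_deriveB _ _ _ (cst (a + b)) id t 1 0 1
        (is_derive_cst (a + b) t 1) (is_derive_id t 1).
      by rewrite sub0r.
    have := @is_derive1_comp _ (fun s => w s x) (fun s : R => a + b - s) _ _ _ h k.
    by rewrite mulrN1.
  rewrite normrN; have /eqP := weq _ x s0 sT.
  by rewrite addr_eq0 => /eqP ->; rewrite normrN.
Qed.

(** Lower semicontinuity of the norm in time comes from continuity of the
    solution at each fixed point; propagation in both directions from
    [growth_propagation] applied to the solution and to its time reversal. *)
Lemma smooth_uniform_growth (R : realType) (g q : R) (T : \bar R)
    (w : R -> R -> R) (b : R) : 0 < g < 1 -> 0 < q < g ->
  smooth_solution g q T w -> 0 <= b -> (b%:E < T)%E ->
  exists N, forall t, 0 <= t <= b -> growth_le q N (w t).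
Proof.
move=> g01 qg sol b0 bT.
have inT t : t <= b -> (t%:E < T)%E by move=> tb; apply: le_lt_trans bT; rewrite lee_fin.
have D0 : 0 < b + 1 by rewrite ltr_wpDl.
have [_ _ [_ _ wc _ _] wfin _] := sol.
apply: (@uniform_of_propagation _ (fun n t => growth_le q n (w t))) => //.
- move=> n m t nm h y y0; apply: (le_trans (h y y0)).
  by rewrite ler_wpM2r ?powR_ge0.
- move=> t /andP[t0 tb]; apply: wnorm_pair_growth_le (wfin t t0 (inT t tb)).
- move=> n t /andP[t0 tb] h y y0.
  rewrite leNgt; apply/negP => hlt.
  have cH : continuous (fun s => `|w (clip 0 b s) y|).
    move=> s; apply: cvg_norm.
    apply: (@cvg_comp _ _ _ (fun s => (clip 0 b s, y)) (fun z => w z.1 z.2) _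
      (within [set z : R * R | 0 <= z.1 /\ (z.1%:E < T)%E] (nbhs (clip 0 b s, y)))); last first.
      move/subspace_continuousP : wc; apply => /=.
      by have /andP[h1 h2] := clip_itv s b0; split => //; exact: inT.
    move=> P hP.
    have cc : (clip 0 b s', y) @[s' --> s] --> (clip 0 b s, y).
      have c1 : clip 0 b s' @[s' --> s] --> clip 0 b s by exact: clip_continuous.
      have c2 : y @[_ --> s] --> y by exact: cvg_cst.
      exact: (cvg_pair c1 c2).
    have hz : \forall s' \near s, 0 <= clip 0 b s' /\ ((clip 0 b s')%:E < T)%E ->
      P (clip 0 b s', y) := cc _ hP.
    rewrite /nbhs/=; apply: filterS hz => s'; apply.
    by have /andP[h1 h2] := clip_itv s' b0; split => //; exact: inT.
  have /(cvgr_gt `|w (clip 0 b t) y|) := cH t.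
  rewrite clip_id ?t0// => /(_ _ hlt)[e /= e0 he].
  have [s sb [ts Ps]] := h e e0.
  by have := he s ts; rewrite /= clip_id// ltNge Ps.
- move=> n n0; have [N hN] := growth_propagation g01 qg n0 D0.
  exists N => c d c0 cd db h1 h2; apply: (hN w c d) => //.
    lra.
  exact: smooth_transported sol c0 (inT d db).
- move=> n n0; have [N hN] := growth_propagation g01 qg n0 D0.
  exists N => c d c0 cd db [N1 h1] h2 t /andP[ct td].
  have -> : t = c + d - (c + d - t) by ring.
  apply: (hN (fun t => w (c + d - t)) c d) => //.
  + lra.
  + exact: smooth_transported_rev sol c0 (inT d db).
  + by exists N1 => s /andP[cs sd]; apply: h1; apply/andP; split; lra.
  + by rewrite addrAC subrr add0r.
  + by apply/andP; split; lra.
Qed.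

(** * The barrier as a subsolution *)

(** The barrier at a time when its scale a(t) equals A; it increases to x^p
    as A decreases to 0. *)
Definition cusp_profile (R : realType) (p A x : R) : R := (x + A) `^ p - A `^ p.

Lemma barrierE (R : realType) (p : R) (a : R -> R) (t x : R) :
  0 < a t -> 0 <= x -> barrier p a t x = cusp_profile p (a t) x.
Proof.
move=> a0 x0; rewrite /barrier /barrier_profile mulrBr mulr1 -powRM ?(ltW a0)//.
  by rewrite mulrDr mulr1 mulrCA mulfV ?gt_eqF// mulr1.
by rewrite addr_ge0// divr_ge0// ltW.
Qed.

Lemma cusp_profile_ge0 (R : realType) (p A x : R) : 0 <= p -> 0 < A -> 0 <= x ->
  0 <= cusp_profile p A x.
Proof.
move=> p0 A0 x0; rewrite subr_ge0; apply: powR_le => //; first exact: ltW.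
by rewrite lerDr.
Qed.

(** Subadditivity of the power p. *)
Lemma cusp_profile_le (R : realType) (p A x : R) : 0 < p < 1 -> 0 < A -> 0 <= x ->
  cusp_profile p A x <= x `^ p.
Proof.
move=> /andP[p0 p1] A0; rewrite le_eqVlt => /predU1P[<-|x0].
  by rewrite /cusp_profile add0r subrr powR_ge0.
have e y : 0 < y -> y `^ p = y * y `^ (p - 1).
  by move=> y0; rewrite powR_mulr//; congr (_ `^ _); ring.
rewrite lerBlDr (e _ (addr_gt0 x0 A0)) mulrDl e// (e A)//.
by apply: lerD; rewrite ler_pM2l//; apply: powR_le_neg => //; lra.
Qed.

(** The product of the constants in the two lower bounds that enter
    [cusp_velocity_le]: for the kernel, where x + y <= 3m, and for the profile,
    from its tangent at m + A <= 2m. *)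
Definition cusp_rate (R : realType) (g p : R) : R :=
  2 * g * 3 `^ (- g - 1) * (p * 2 `^ (p - 1)).

Lemma cusp_rate_gt0 (R : realType) (g p : R) : 0 < g -> 0 < p ->
  0 < cusp_rate g p.
Proof. by move=> g0 p0; rewrite !mulr_gt0// powR_gt0. Qed.

(** On the window m < y <= 2m with m = max(x, A) the kernel is at least of
    order x m^(-g-1) and the profile of order m^p, so the window contributes
    x m^(p-g) = x m^(-p), because p = g/2. This dominates
    (x + A)^(1-p) - A^(1-p): write (x + A)^(1-p) as (x + A) (x + A)^(-p) and
    bound the factor (x + A)^(-p) by m^(-p) and by A^(-p). *)
Lemma cusp_velocity_le (R : realType) (g p A x J J' : R) (f w e : R -> R) :
  0 < g < 1 -> p = g / 2 -> 0 < A -> 0 < x ->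
  measurable_fun [set: R] f -> measurable_fun [set: R] w ->
  measurable_fun [set: R] e ->
  (forall y, 0 <= y -> `|f y| <= w y) -> (forall y, 0 <= y -> 0 <= e y) ->
  (\int[lebesgue_measure]_(y in `[0%R, +oo[) (pos_kernel g x y * w y)%:E <= J'%:E)%E ->
  (\int[lebesgue_measure]_(y in `[0%R, +oo[) (pos_kernel g x y * e y)%:E <= J%:E)%E ->
  (forall y, 0 <= y -> cusp_profile p A y <= f y + e y) ->
  velocity g f x <= J - cusp_rate g p * ((x + A) `^ (1 - p) - A `^ (1 - p)).
Proof.
move=> g01 pE A0 x0 mf mw me fw e0 kJ' kJ hf; have /andP[g0 g1] := g01.
have p0 : 0 < p by rewrite pE; lra.
have p1 : p < 1 by rewrite pE; lra.
pose m := Num.max x A.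
have m0 : 0 < m by rewrite lt_max x0.
have xm : x <= m by rewrite le_max lexx.
have Am : A <= m by rewrite le_max lexx orbT.
have m30 : 0 < 3 * m by rewrite mulr_gt0.
have m20 : 0 < 2 * m by rewrite mulr_gt0.
pose k := 2 * g * x * (3 * m) `^ (- g - 1).
pose c := p * (2 * m) `^ (p - 1) * m.
have k0 : 0 <= k by rewrite !mulr_ge0 ?powR_ge0// ltW.
have c0 : 0 <= c by rewrite !mulr_ge0 ?powR_ge0// ltW.
have hc y : m < y <= 2 * m -> c <= f y + e y.
  move=> /andP[my _]; have y0 : 0 <= y by rewrite ltW// (lt_trans m0).
  apply: le_trans (hf y y0).
  apply: (@le_trans _ _ (cusp_profile p A m)).
    have := @powR_tangent R A (m + A) p (ltW A0) _ _ _.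
    rewrite lerDr (ltW m0) addr_gt0// p0 p1 => /(_ erefl erefl erefl).
    rewrite addrK; apply: le_trans; rewrite ler_pM2r// ler_pM2l//.
    by apply: powR_le_neg; rewrite ?addr_gt0//; lra.
  by rewrite lerD2r; apply: powR_le; rewrite ?addr_ge0 ?(ltW m0) ?(ltW A0) ?(ltW p0)// lerD2r ltW.
have hk y : m < y <= 2 * m -> k <= pos_kernel g x y.
  move=> /andP[my y2m]; have xy : x < y by exact: le_lt_trans my.
  apply: le_trans (pos_kernel_ge g01 x0 xy).
  rewrite ler_pM2l ?mulr_gt0//; apply: powR_le_neg; first by rewrite addr_gt0// (lt_trans x0).
    by lra.
  by lra.
have fe0 y : 0 <= y -> 0 <= f y + e y.
  by move=> y0; apply: le_trans (hf y y0); apply: cusp_profile_ge0 => //; exact: ltW.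
apply: (le_trans (velocity_le g0 x0 m0 k0 c0 mf mw me fw e0 kJ' kJ fe0 hc hk)).
rewrite lerD2l lerN2.
have kcm : k * c * m = cusp_rate g p * (x * m `^ (- p)).
  have e1 : m `^ (- p) = m * m * (m `^ (- g - 1) * m `^ (p - 1)).
    by rewrite -powRD_pos// -mulrA !powR_mulr//; congr (_ `^ _); rewrite pE; field.
  rewrite e1 /k /c /cusp_rate !powRM ?(ltW m0)//; ring.
rewrite kcm ler_pM2l ?cusp_rate_gt0//.
have xA0 : 0 < x + A by rewrite addr_gt0.
have e2 y : 0 < y -> y `^ (1 - p) = y * y `^ (- p) by move=> y0; rewrite powR_mulr.
rewrite (e2 _ xA0) (e2 _ A0) lerBlDr mulrDl; apply: lerD.
  rewrite ler_pM2l//; apply: powR_le_neg => //; last by rewrite oppr_le0 ltW.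
  by rewrite ge_max lerDl lerDr !ltW.
by rewrite ler_pM2l//; apply: powR_le_neg; rewrite ?oppr_le0 ?(ltW p0)// lerDr ltW.
Qed.

Lemma is_derive_cusp_profile_space (R : realType) (p A x : R) : 0 < x + A ->
  is_derive x 1 (cusp_profile p A) (p * (x + A) `^ (p - 1)).
Proof.
move=> xA; have Ax : 0 < A + x by rewrite addrC.
have h := is_derive_shift_powR p Ax.
have := @is_deriveB _ _ _ _ (cst (A `^ p)) x 1 _ 0 h (is_derive_cst (A `^ p) x 1).
rewrite subr0 (addrC x).
suff -> : cusp_profile p A = (fun y => (A + y) `^ p) - cst (A `^ p) by [].
by apply/funext => y; rewrite /cusp_profile (addrC y).
Qed.

Lemma is_derive_cusp_profile_time (R : realType) (p c x t : R) (a : R -> R) :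
  0 < a t -> 0 <= x -> is_derive t 1 a (- c * a t `^ (1 - p)) ->
  is_derive t 1 (fun s => cusp_profile p (a s) x)
    (c * p * (1 - a t `^ (1 - p) * (x + a t) `^ (p - 1))).
Proof.
move=> a0 x0 da; have xa0 : 0 < x + a t by rewrite ltr_wpDl.
have h1 := @is_derive1_comp _ (fun z => (x + z) `^ p) a _ _ _
  (is_derive_shift_powR p xa0) da.
have h2 := @is_derive1_comp _ (fun z => z `^ p) a _ _ _ (is_derive1_powR p a0) da.
have := @is_deriveB _ _ _ _ _ t 1 _ _ h1 h2.
set d := (X in is_derive _ _ _ X -> _).
suff -> : d = c * p * (1 - a t `^ (1 - p) * (x + a t) `^ (p - 1)) by [].
have e : a t `^ (1 - p) * a t `^ (p - 1) = 1.
  by rewrite -powRD_pos// (_ : 1 - p + (p - 1) = 0) ?powRr0//; ring.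
rewrite /d; transitivity (c * p * (a t `^ (1 - p) * a t `^ (p - 1)
  - a t `^ (1 - p) * (x + a t) `^ (p - 1))); first by ring.
by rewrite e.
Qed.

Lemma within_continuous_fst (R : realType) (A : set (R * R)) (I : set R) (a : R -> R) :
  {within I, continuous a} -> (forall z, A z -> I z.1) ->
  {within A, continuous (fun z => a z.1)}.
Proof.
move=> /subspace_continuousP ca AI; apply/subspace_continuousP => z Az.
apply: (@cvg_comp _ _ _ fst a _ (within I (nbhs z.1))); last by apply: ca; exact: AI.
move=> P hP.
have cfst : (fst : R * R -> R) z' @[z' --> z] --> z.1 by exact: cvg_fst.
have hz : \forall z' \near z, I z'.1 -> P z'.1 := cfst _ hP.
by rewrite /within/= /nbhs/=; apply: filterS hz => z' h /AI.
Qed.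

(** * Comparison of the solution with the barrier *)

(** The inequality - u psi_x >= 2 psi_t up to the error J psi_x, with
    psi_x = p (x + A)^(p-1) and psi_t as in [is_derive_cusp_profile_time]. *)
Lemma cusp_balance (R : realType) (p A x c u J : R) : 0 < p < 1 -> 0 < A -> 0 < x ->
  u <= J - 2 * c * ((x + A) `^ (1 - p) - A `^ (1 - p)) ->
  2 * (c * p * (1 - A `^ (1 - p) * (x + A) `^ (p - 1))) - J * (p * (x + A) `^ (p - 1))
    <= - (u * (p * (x + A) `^ (p - 1))).
Proof.
move=> /andP[p0 p1] A0 x0 hu; have xA0 : 0 < x + A by rewrite addr_gt0.
have e : (x + A) `^ (1 - p) * (x + A) `^ (p - 1) = 1.
  by rewrite -powRD_pos// (_ : 1 - p + (p - 1) = 0) ?powRr0//; ring.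
have P0 : 0 <= p * (x + A) `^ (p - 1) by rewrite mulr_ge0 ?powR_ge0// ltW.
have := ler_wpM2r P0 hu.
have -> : (J - 2 * c * ((x + A) `^ (1 - p) - A `^ (1 - p))) * (p * (x + A) `^ (p - 1)) =
  J * (p * (x + A) `^ (p - 1)) -
  2 * c * p * ((x + A) `^ (1 - p) * (x + A) `^ (p - 1) - A `^ (1 - p) * (x + A) `^ (p - 1))
  by ring.
by rewrite e; lra.
Qed.

Lemma cusp_profile_dt_gt0 (R : realType) (p A x c : R) : 0 < p < 1 -> 0 < A -> 0 < x ->
  0 < c -> 0 < c * p * (1 - A `^ (1 - p) * (x + A) `^ (p - 1)).
Proof.
move=> /andP[p0 p1] A0 x0 c0; rewrite !mulr_gt0// subr_gt0.
have e : A `^ (1 - p) * A `^ (p - 1) = 1.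
  by rewrite -powRD_pos// (_ : 1 - p + (p - 1) = 0) ?powRr0//; ring.
rewrite -[ltRHS]e ltr_pM2l ?powR_gt0//; apply: powR_lt_neg; lra.
Qed.

Lemma smooth_is_derive_time (R : realType) (g q : R) (T : \bar R) (w : R -> R -> R)
    (t x : R) : smooth_solution g q T w -> 0 < t -> (t%:E < T)%E ->
  is_derive t 1 (fun s => w s x) (- (velocity g (w t) x * dx w t x)).
Proof.
move=> [_ _ [_ wdt _ _ _] _ weq] t0 tT.
have := weq t x t0 tT; move/eqP; rewrite addr_eq0 => /eqP <-.
exact: derivable_is_derive1 (wdt t x t0 tT).
Qed.

Lemma barrier_scale_lower (R : realType) (p c a0 T b : R) (a : R -> R) :
  barrier_scale p c a0 T a -> 0 <= b -> b < T ->
  exists2 m, 0 < m <= 1 & forall t, 0 <= t <= b -> m <= a t.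
Proof.
move=> [ca _ _ _ apos] b0 bT.
have cab : {within `[0, b], continuous a}.
  apply: continuous_subspaceW ca => t /=; rewrite !in_itv/= => /andP[-> tb].
  by rewrite (le_trans tb)// ltW.
have [s] := EVT_min b0 cab; rewrite in_itv/= => /andP[s0 sb] smin.
have as0 : 0 < a s by apply: apos; rewrite s0 (le_lt_trans sb).
exists (Num.min 1 (a s)); first by rewrite lt_min ltr01 as0/= ge_min lexx.
by move=> t tb; rewrite ge_min smin ?orbT// in_itv.
Qed.

(** First touching for w - psi + dl exp(K s) (1 + y)^r. At a contact point
    w_x = psi_x - E_x, where E is the perturbation, so the time derivative is
    - u psi_x + u E_x - psi_t + K E. Here - u psi_x exceeds psi_t up to an
    error due to w >= psi - E only, and both this error and u E_x are bounded
    by multiples of E; K is the sum of these multiples plus 1. The exponent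
    r > q makes E dominate at infinity, r >= p makes it absorb (1 + y) psi_x. *)
Lemma solution_ge_cusp (R : realType) (g p q c0 a0 T b : R) (Tbar : \bar R)
    (a : R -> R) (w : R -> R -> R) :
  0 < g < 1 -> p = g / 2 -> 0 < q < g -> c0 = cusp_rate g p / 2 ->
  barrier_scale p c0 a0 T a -> smooth_solution g q Tbar w ->
  (forall x, 0 <= x -> cusp_profile p (a 0) x <= w 0 x) ->
  0 <= b -> b < T -> (b%:E < Tbar)%E ->
  forall t x, 0 <= t <= b -> 0 <= x -> cusp_profile p (a t) x <= w t x.
Proof.
move=> g01 pE qg c0E scale sol init b0 bT bTbar t x.
have g0 : 0 < g by case/andP: g01.
have p0 : 0 < p by rewrite pE divr_gt0.
have p01 : 0 < p < 1 by apply/andP; split=> //; case/andP: g01 => *; rewrite pE; lra.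
have /andP[_ p1] := p01.
have pg : p < g by rewrite pE; lra.
have c00 : 0 < c0 by rewrite c0E divr_gt0// cusp_rate_gt0.
have inT s : s <= b -> (s%:E < Tbar)%E.
  by move=> sb; apply: le_lt_trans bTbar; rewrite lee_fin.
have [ca ader _ _ apos'] := scale.
have apos s : 0 <= s <= b -> 0 < a s.
  by move=> /andP[s0 sb]; apply: apos'; rewrite s0 (le_lt_trans sb).
have [_ wx0 wder' _] := smooth_transported sol (lexx 0) bTbar.
have wder s y : 0 <= s <= b -> derivable (w s) y 1 by exact: wder'.
have wmeas s : 0 <= s <= b -> measurable_fun [set: R] (w s).
  by move=> sb; apply: derivable_measurable => y; exact: wder.
have [N0 hN0] := smooth_uniform_growth g01 qg sol b0 bTbar.
pose N := Num.max N0 0.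
have N_ge0 : 0 <= N by rewrite le_max lexx orbT.
have hN s y : 0 <= s <= b -> 0 <= y -> `|w s y| <= N * (1 + y) `^ q.
  move=> sb y0; apply: (le_trans (hN0 s sb y y0)).
  by rewrite ler_wpM2r ?powR_ge0// le_max lexx.
have [m /andP[m0 m1] ham] := barrier_scale_lower scale b0 bT.
have /andP[q0 qltg] := qg; have /andP[_ g1] := g01.
have qpg : Num.max q p < g by rewrite gt_max qltg pg.
have [r /andP[qpr rg]] : exists r, Num.max q p < r < g.
  by exists ((Num.max q p + g) / 2); apply/andP; split; lra.
have qr : q < r by apply: le_lt_trans qpr; rewrite le_max lexx.
have pr : p < r by apply: le_lt_trans qpr; rewrite le_max lexx orbT.
have r0 : 0 < r by exact: lt_trans qr.
have [Cq Cq0 hCq] := riesz_kernel_weight_bound g01 qg.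
have [|Cr Cr0 hCr] := @riesz_kernel_weight_bound R g r g01; first by rewrite r0.
(* the three terms absorb u E_x, the velocity error times psi_x, and leave E *)
pose K := N * Cq * r + Cr * (p * m `^ (p - 1)) + 1.
have K0 : 0 < K.
  have k1 : 0 <= N * Cq * r by rewrite !mulr_ge0// ltW.
  have k2 : 0 <= Cr * (p * m `^ (p - 1)) by rewrite !mulr_ge0 ?powR_ge0// ltW.
  by rewrite ltr_wpDl// addr_ge0.
suff perturbed dl s y : 0 < dl -> 0 <= s <= b -> 0 <= y ->
    0 < w s y - cusp_profile p (a s) y + dl * expR (K * s) * (1 + y) `^ r.
  move=> tb x0; apply/ler_addgt0Pr => e e0.
  have P0 : 0 < expR (K * t) * (1 + x) `^ r.
    by rewrite mulr_gt0 ?expR_gt0// powR_gt0 ?ltr_wpDr.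
  have := perturbed (e / (expR (K * t) * (1 + x) `^ r)) t x (divr_gt0 e0 P0) tb x0.
  by rewrite -mulrA divfK ?gt_eqF// => h; apply: ltW; lra.
move=> dl0.
pose E (s y : R) := dl * expR (K * s) * (1 + y) `^ r.
have E0 s' y' : 0 <= y' -> 0 < E s' y'.
  by move=> y'0; rewrite !mulr_gt0 ?expR_gt0// powR_gt0 ?ltr_wpDr.
pose h (s y : R) := w s y - cusp_profile p (a s) y + E s y.
have [|L L0 hL] := @powR_dominates R (Num.max q p) r (N + 1) dl _ dl0 qpr.
  by rewrite addr_ge0.
have [_ _ [_ _ wc _ _] _ _] := sol.
apply: (@first_touching _ h 0 b L b0 L0).
- pose A := [set z : R * R | 0 <= z.1 <= b /\ 0 <= z.2].
  rewrite -/A.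
  have cw : {within A, continuous (fun z => w z.1 z.2)}.
    apply: continuous_subspaceW wc => z [/andP[z0 zb] _] /=.
    by split => //; exact: inT.
  have caA : {within A, continuous (fun z => a z.1)}.
    apply: within_continuous_fst ca _ => z [/andP[z0 zb] _] /=.
    by rewrite in_itv/= z0 (le_trans zb)// ltW.
  have csnd : {within A, continuous (fun z => z.2)}.
    by apply: continuous_subspaceT => z; exact: cvg_snd.
  have cE : {within A, continuous (fun z => E z.1 z.2)}.
    move=> z; apply: (@cvgM _ _ _ _ (fun z : R * R => dl * expR (K * z.1))
       (fun z => (1 + z.2) `^ r)).
      have ce : continuous (fun z : R * R => dl * expR (K * z.1)).
        move=> z'; apply: cvgM; first exact: cvg_cst.
        apply: (@cvg_comp _ _ _ (fun z : R * R => K * z.1) expR _ (nbhs (K * z'.1))).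
          by apply: cvgM; [exact: cvg_cst|exact: cvg_fst].
        exact: continuous_expR.
      exact: (continuous_subspaceT ce).
    have cs : {within A, continuous (fun z => (1 + z.2) `^ r)}.
      apply: within_continuous_powR => [z'|z' [_ z'0]]; last by rewrite ltr_wpDr.
      by apply: cvgD; [exact: cvg_cst|exact: csnd].
    exact: cs.
  have cpsi : {within A, continuous (fun z => cusp_profile p (a z.1) z.2)}.
    apply: within_continuous_sub; apply: within_continuous_powR => //.
    + by move=> z; apply: cvgD; [exact: csnd|exact: caA].
    + by move=> z [zb z0]; rewrite ltr_wpDl// apos.
    + by move=> z [zb z0]; exact: apos.
  move=> z; apply: (@cvgD _ _ _ _ _ (fun z => w z.1 z.2 - cusp_profile p (a z.1) z.2)
    (fun z => E z.1 z.2)); last exact: cE.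
  exact: within_continuous_sub cw cpsi z.
- by move=> y' y'0; rewrite ltr_wpDl// ?E0// subr_ge0 init.
- move=> s' s'b; have psi0 : cusp_profile p (a s') 0 = 0 by rewrite /cusp_profile add0r subrr.
  by rewrite /h wx0// psi0 subr0 add0r E0.
- move=> s' y' s'b Ly'; have y'0 : 0 <= y' := le_trans L0 Ly'.
  have y1 : 1 <= 1 + y' by rewrite lerDl.
  have y10 : 0 < 1 + y' by exact: lt_le_trans y1.
  have /andP[s'0 _] := s'b.
  have h1 : dl * (1 + y') `^ r <= E s' y'.
    rewrite ler_pM2r ?powR_gt0// ler_peMr ?(ltW dl0)//.
    apply: le_trans (expR_ge1Dx _); rewrite lerDl mulr_ge0//.
    exact: (ltW K0).
  have h2 : - (N * (1 + y') `^ Num.max q p) <= w s' y'.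
    rewrite lerNl; apply: (le_trans (ler_norm _)); rewrite normrN.
    apply: (le_trans (hN s' y' s'b y'0)); apply: ler_wpM2l => //.
    by apply: ler_powR => //; rewrite le_max lexx.
  have h3 : cusp_profile p (a s') y' <= (1 + y') `^ Num.max q p.
    apply: (le_trans (cusp_profile_le p01 (apos s' s'b) y'0)).
    apply: (@le_trans _ _ ((1 + y') `^ p)).
      by apply: powR_le => //; [rewrite lerDr|exact: ltW].
    by apply: ler_powR => //; rewrite le_max lexx orbT.
  have h4 := hL (1 + y') (le_trans Ly' _) y10.
  rewrite lerDr ler01 in h4; have {}h4 := h4 erefl.
  rewrite mulrDl mul1r in h4; rewrite /h.
  move: h1 h2 h3 h4; clear; lra.
- move=> s' y' /andP[s'0 s'b] y'0.
  have s'b' : 0 <= s' <= b by rewrite ltW.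
  have ya0 : 0 < y' + a s' by rewrite addr_gt0// apos.
  have y10 : 0 < 1 + y' by rewrite addr_gt0.
  have h1 := derivable_is_derive1 (wder s' y' s'b').
  have h2 := is_derive_cusp_profile_space p ya0.
  have h3 := is_derive_shift_powR r y10.
  exact: (@ex_derive _ _ _ _ _ _ _ (is_deriveD (is_deriveB h1 h2)
    (is_deriveZ (dl * expR (K * s')) h3))).
move=> {s y} s y sb y0 hsy hge dh0; have y0' := ltW y0.
have /andP[s0 sb2] := sb.
have sb' : 0 <= s <= b by rewrite ltW.
have As0 := apos s sb'; set A := a s in As0.
have ya0 : 0 < y + A by rewrite addr_gt0.
have y10 : 0 < 1 + y by rewrite addr_gt0.
pose wx := dx w s y; pose px := p * (y + A) `^ (p - 1).
pose e := dl * expR (K * s).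
have e0 : 0 < e by rewrite mulr_gt0 ?expR_gt0.
pose Ex := e * (r * (1 + y) `^ (r - 1)).
have slope : wx = px - Ex.
  have h1 : is_derive y 1 (w s) wx := derivable_is_derive1 (wder s y sb').
  have h2 := is_derive_cusp_profile_space p ya0.
  have h3 : is_derive y 1 (fun z => e * (1 + z) `^ r) Ex.
    exact: (is_deriveZ e (is_derive_shift_powR r y10)).
  have := is_derive_unique (is_deriveD (is_deriveB h1 h2) h3) dh0.
  by rewrite -/px; clear; lra.
set u := velocity g (w s) y.
pose pt := c0 * p * (1 - A `^ (1 - p) * (y + A) `^ (p - 1)).
have dht : is_derive s 1 (h^~ y) (- (u * wx) - pt + K * E s y).
  have h1 := smooth_is_derive_time y sol s0 (inT s sb2).
  have h2 := is_derive_cusp_profile_time As0 y0' (ader s (introT andP (conj s0 (le_lt_trans sb2 bT)))).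
  have h3 : is_derive s 1 (fun z : R => expR (K * z)) (expR (K * s) * K).
    apply: (@is_derive1_comp _ expR (fun z : R => K * z)).
    by apply: is_derive_eq; rewrite ?scaler0 ?add0r /GRing.scale/= ?mulr1.
  have h4 := @is_deriveZ _ _ _ _ (dl * (1 + y) `^ r) _ _ _ h3.
  have h5 := is_deriveD (is_deriveB h1 h2) h4.
  have -> : h^~ y = (fun z => w z y) - (fun z => cusp_profile p (a z) y) +
     (dl * (1 + y) `^ r) *: (fun z : R => expR (K * z)).
    by apply/funext => z; rewrite /h /E mulrAC.
  apply: (is_derive_eq h5); rewrite -/u -/wx -/pt; congr (_ + _).
  by rewrite /E /GRing.scale/=; ring.
exists (- (u * wx) - pt + K * E s y) => //.
have mW c s' : measurable_fun [set: R] (fun z => c * (1 + z) `^ s').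
  by apply: measurable_funM => //; exact: measurable_shift_powR.
have kw := riesz_kernel_scaled_bound N_ge0 (hCq 1 y ltr01 y0).
have kE := riesz_kernel_scaled_bound (ltW e0) (hCr 1 y ltr01 y0).
rewrite powR1 mulr1 in kw; rewrite powR1 mulr1 in kE.
have unorm : `|u| <= N * (Cq * (1 + y)).
  apply: (velocity_norm_le g0 y0 (wmeas s sb') (mW N q) _ kw) => z z0.
  exact: hN.
have uup : u <= e * (Cr * (1 + y)) - 2 * c0 * ((y + A) `^ (1 - p) - A `^ (1 - p)).
  rewrite (_ : 2 * c0 = cusp_rate g p); last by rewrite c0E; field.
  apply: (cusp_velocity_le g01 pE As0 y0 (wmeas s sb') (mW N q) (mW e r) _ _ kw kE).
  - by move=> z z0; exact: hN.
  - by move=> z z0; rewrite mulr_ge0 ?powR_ge0// ltW.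
  - move=> z z0; have := hge z z0; rewrite /h /E -/A -/e.
    by move: (w s z) (cusp_profile p A z) (_ * _) => ? ? ?; lra.
(* the barrier gains 2 psi_t against the psi_t that it loses *)
have bal := cusp_balance p01 As0 y0 uup.
have pt0 : 0 < pt by exact: cusp_profile_dt_gt0.
rewrite -/px -/pt in bal.
have e1 z : (1 + y) * (1 + y) `^ (z - 1) = (1 + y) `^ z.
  by rewrite powR_mulr//; congr (_ `^ _); ring.
have uEx : `|u * Ex| <= N * Cq * r * E s y.
  have Ex0 : 0 <= Ex by rewrite !mulr_ge0 ?powR_ge0// ltW.
  rewrite normrM (ger0_norm Ex0).
  apply: (@le_trans _ _ (N * (Cq * (1 + y)) * Ex)); first exact: ler_wpM2r.
  rewrite /E -/e /Ex -(e1 r) le_eqVlt; apply/orP; left; apply/eqP; ring.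
have Jpx : e * (Cr * (1 + y)) * px <= Cr * (p * m `^ (p - 1)) * E s y.
  have h1 : (y + A) `^ (p - 1) <= m `^ (p - 1) * (1 + y) `^ (p - 1).
    rewrite -powRM ?(ltW m0) ?(ltW y10)//.
    apply: powR_le_neg; rewrite ?mulr_gt0// ?subr_le0 ?(ltW p1)//.
    have := ham s sb'; rewrite -/A => mA.
    rewrite mulrDr mulr1 addrC; apply: lerD => //.
    by rewrite ler_piMl.
  have h2 : (1 + y) `^ p <= (1 + y) `^ r.
    by apply: ler_powR; rewrite ?lerDl// ltW.
  apply: (@le_trans _ _ (e * (Cr * (1 + y)) * (p * (m `^ (p - 1) * (1 + y) `^ (p - 1))))).
    by rewrite !(ler_wpM2l, mulr_ge0)// ltW.
  rewrite /E -/e (_ : e * (Cr * (1 + y)) * (p * (m `^ (p - 1) * (1 + y) `^ (p - 1))) =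
    Cr * (p * m `^ (p - 1)) * (e * ((1 + y) * (1 + y) `^ (p - 1)))); last by ring.
  rewrite e1; apply: ler_wpM2l; first by rewrite !mulr_ge0 ?powR_ge0// ltW.
  by rewrite ler_pM2l.
have EE := E0 s y y0'.
have := ler_norm (- (u * Ex)); rewrite normrN => uEx'.
rewrite slope /K !mulrDl mul1r.
move: bal pt0 uEx Jpx EE uEx'.
rewrite mulrBr.
by clear; lra.
Qed.

(** A contact in spite of w >= psi is a minimum of w - psi, both in space and
    in past times, so w_t <= psi_t and w_x = psi_x there. But
    w_t = - u psi_x >= 2 psi_t > psi_t. *)
Lemma solution_gt_cusp (R : realType) (g p q c0 a0 T b : R) (Tbar : \bar R)
    (a : R -> R) (w : R -> R -> R) :
  0 < g < 1 -> p = g / 2 -> 0 < q < g -> c0 = cusp_rate g p / 2 ->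
  barrier_scale p c0 a0 T a -> smooth_solution g q Tbar w ->
  (forall x, 0 <= x -> cusp_profile p (a 0) x <= w 0 x) ->
  0 < b -> b < T -> (b%:E < Tbar)%E ->
  forall x, 0 < x -> cusp_profile p (a b) x < w b x.
Proof.
move=> g01 pE qg c0E scale sol init b0 bT bTbar x x0.
have ge := solution_ge_cusp g01 pE qg c0E scale sol init (ltW b0) bT bTbar.
have g0 : 0 < g by case/andP: g01.
have p0 : 0 < p by rewrite pE divr_gt0.
have p01 : 0 < p < 1 by apply/andP; split=> //; case/andP: g01 => *; rewrite pE; lra.
have c00 : 0 < c0 by rewrite c0E divr_gt0// cusp_rate_gt0.
have [_ ader _ _ apos] := scale.
have bb : 0 <= b <= b by rewrite lexx ltW.
have Ab0 : 0 < a b by apply: apos; rewrite ltW.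
have [_ _ wder _] := smooth_transported sol (lexx 0) bTbar.
rewrite ltNge; apply/negP => wle.
have wE : w b x = cusp_profile p (a b) x by apply/le_anti; rewrite wle ge// ltW.
have xA0 : 0 < x + a b by rewrite addr_gt0.
pose px := p * (x + a b) `^ (p - 1).
pose pt := c0 * p * (1 - a b `^ (1 - p) * (x + a b) `^ (p - 1)).
have dwx (y : R) : is_derive y 1 (w b) (dx w b y) := derivable_is_derive1 (wder b y bb).
have slope : dx w b x = px.
  have h1 := is_deriveB (dwx x) (is_derive_cusp_profile_space p xA0).
  have h2 : is_derive x 1 (w b - cusp_profile p (a b)) 0.
    apply: is_derive0_of_min => // [y y0|y y0].
      have yA0 : 0 < y + a b by rewrite addr_gt0.
      exact: (@ex_derive _ _ _ _ _ _ _
        (is_deriveB (dwx y) (is_derive_cusp_profile_space p yA0))).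
    by rewrite !fctE wE subrr subr_ge0 ge// ltW.
  by have /eqP := is_derive_unique h1 h2; rewrite subr_eq0 => /eqP.
set u := velocity g (w b) x.
have dt0 : - (u * px) - pt <= 0.
  have h1 := smooth_is_derive_time x sol b0 bTbar.
  have db : 0 < b < T by rewrite b0.
  have h2 := is_derive_cusp_profile_time Ab0 (ltW x0) (ader b db).
  have := is_deriveB h1 h2; rewrite slope => h3.
  apply: (derive_le0_of_left_min b0 h3) => s /andP[s0 sb].
  by rewrite !fctE wE subrr subr_ge0 ge ?s0 ?ltW.
have [q0 qltg] := andP qg.
have [_ _ _ wfin _] := sol.
have [N hN] := wnorm_pair_growth_le (wfin b (ltW b0) bTbar).
have [Cq Cq0 hCq] := riesz_kernel_weight_bound g01 qg.
have mw : measurable_fun [set: R] (w b).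
  by apply: derivable_measurable => y; exact: wder.
have mW : measurable_fun [set: R] (fun z => N * (1 + z) `^ q).
  by apply: measurable_funM => //; exact: measurable_shift_powR.
have m0 : measurable_fun [set: R] (fun _ : R => 0 : R) by exact: measurable_cst.
have N0 : 0 <= N.
  by have := hN 0 (lexx 0); rewrite addr0 powR1 mulr1; exact: le_trans.
have kw := riesz_kernel_scaled_bound N0 (hCq 1 x ltr01 x0).
have k0 : (\int[lebesgue_measure]_(y in `[0%R, +oo[) (pos_kernel g x y * 0)%:E
    <= 0%:E)%E.
  by under eq_integral do rewrite mulr0; rewrite integral0.
have uup : u <= 0 - 2 * c0 * ((x + a b) `^ (1 - p) - a b `^ (1 - p)).
  rewrite (_ : 2 * c0 = cusp_rate g p); last by rewrite c0E; field.
  apply: (cusp_velocity_le g01 pE Ab0 x0 mw mW m0 hN _ kw k0) => // y y0.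
  by rewrite addr0 ge.
have := cusp_balance p01 Ab0 x0 uup.
have := cusp_profile_dt_gt0 p01 Ab0 x0 c00.
rewrite -/px -/pt mul0r; move: dt0; clear; lra.
Qed.

(** Both functions vanish at 0, so their order on the right orders the
    derivatives. The reflection y |-> - y reduces this to the statement on
    minima approached from the left. *)
Lemma cusp_slope_le (R : realType) (p A d : R) (f : R -> R) : 0 < A ->
  is_derive (0 : R) 1 f d -> f 0 = 0 ->
  (forall x, 0 <= x -> cusp_profile p A x <= f x) ->
  p * A `^ (p - 1) <= d.
Proof.
move=> A0 df f0 hf.
have A0' : 0 < 0 + A by rewrite add0r.
have h := is_deriveB df (is_derive_cusp_profile_space p A0').
rewrite add0r in h.
have hN : is_derive (0 : R) 1 (fun y : R => - y) (- 1 : R).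
  exact: (is_deriveN (is_derive_id (0 : R) 1)).
have e0 : - (0 : R) = 0 by rewrite oppr0.
rewrite -[X in is_derive X]e0 in h.
have k := @is_derive1_comp _ (f - cusp_profile p A) (fun y : R => - y) _ _ _ h hN.
rewrite mulrN1 in k.
have := derive_le0_of_left_min (ltrN10 R) k.
rewrite oppr_le0 subr_ge0; apply=> s /andP[_ s0].
have psi0 : cusp_profile p A 0 = 0 by rewrite /cusp_profile add0r subrr.
by rewrite !fctE /= oppr0 f0 psi0 subrr subr_ge0 hf// oppr_ge0 ltW.
Qed.

Lemma powR_neg_ge (R : realType) (s M : R) : s < 0 ->
  exists2 eta : R, 0 < eta & forall z, 0 < z -> z < eta -> M <= z `^ s.
Proof.
move=> s0; have M0 : 0 < `|M| + 1 by rewrite ltr_wpDl.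
exists ((`|M| + 1) `^ s^-1); first exact: powR_gt0.
move=> z z0 zeta.
have : ((`|M| + 1) `^ s^-1) `^ s <= z `^ s by apply: powR_le_neg; rewrite ?ltW.
rewrite -powRrM mulVf ?lt_eqF// powRr1 ?(ltW M0)//; apply: le_trans.
by rewrite (le_trans (ler_norm _))// lerDl.
Qed.

(** * Breakdown and formation of the cusp *)

Lemma barrier_scale_cvg0 (R : realType) (p c a0 T : R) (a : R -> R) : 0 < T ->
  barrier_scale p c a0 T a -> a t @[t --> T^'-] --> 0.
Proof.
move=> T0 [ca _ _ aT _]; move: ca => /(continuous_within_itvP _ T0)[_ _].
by rewrite aT.
Qed.

(** A smooth solution beyond T would have a bounded slope at the origin. *)
Lemma dx_cvg_left (R : realType) (g q T : R) (Tbar : \bar R) (w : R -> R -> R) :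
  0 < T -> (T%:E < Tbar)%E -> smooth_solution g q Tbar w ->
  dx w t 0 @[t --> T^'-] --> dx w T 0.
Proof.
move=> T0 TT [_ _ [_ _ _ /subspace_continuousP wc _] _ _].
apply: (@cvg_comp _ _ _ (fun t : R => (t, 0 : R)) (fun z => dx w z.1 z.2) _
  (within [set z : R * R | 0 <= z.1 /\ (z.1%:E < Tbar)%E] (nbhs (T, 0 : R)))); last first.
  by apply: wc => /=; split => //; exact: ltW.
move=> P hP.
have c1 : t @[t --> T] --> T by exact: cvg_id.
have c2 : (0 : R) @[_ --> T] --> (0 : R) by exact: cvg_cst.
have cc : (t, 0 : R) @[t --> T] --> (T, 0 : R) by exact: (cvg_pair c1 c2).
have hz : \forall t \near T, 0 <= t /\ (t%:E < Tbar)%E -> P (t, 0) := cc _ hP.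
have h0 : \forall t \near T, 0 < t by exact: lt_nbhsr.
rewrite /nbhs/= /at_left /within /=; near=> t => tT.
have Pt : 0 <= t /\ (t%:E < Tbar)%E -> P (t, 0) by near: t.
apply: Pt; split; first by apply: ltW; near: t.
by apply: lt_trans TT; rewrite lte_fin.
Unshelve. all: by end_near. Qed.

Theorem theorem2 (R : realType) (alpha gamma p : R)
    (halpha : 0 < alpha < 1) (hgamma : gamma = 1 - alpha) (hp : p = gamma / 2) :
  exists2 c0 : R, 0 < c0 &
  forall (a0 T : R) (a : R -> R) (q : R) (Tbar : \bar R) (w : R -> R -> R)
    (eps : R),
    0 < a0 < 1 -> 0 < T -> barrier_scale p c0 a0 T a ->
    0 < q < gamma -> maximal_smooth_solution gamma q Tbar w ->
    (wnorm p (w 0%R) + wnorm (p - 1)%R (dx w 0%R) < +oo)%E ->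
    0 < eps -> (1 - a0 `^ p)^-1 - 1 < eps ->
    (forall x, 0 < x -> (1 + eps) * barrier p a 0 x < w 0 x) ->
    [/\ (Tbar <= T%:E)%E,
        forall t x, 0 <= t -> (t%:E < Tbar)%E -> 0 < x ->
          barrier p a t x < w t x &
        Tbar = T%:E -> at_least_cusp p T w].
Proof.
have g01 : 0 < gamma < 1 by rewrite hgamma; case/andP: halpha => *; apply/andP; split; lra.
have /andP[g0 g1] := g01.
have p0 : 0 < p by rewrite hp divr_gt0.
have p1 : p < 1 by rewrite hp; lra.
(* half of the rate at which the solution is pushed up leaves a factor 2 *)
exists (cusp_rate gamma p / 2); first by rewrite divr_gt0// cusp_rate_gt0.
move=> a0 T a q Tbar w eps _ T0 scale qg [Tbar0 sol _] _ eps0 _ w0gt.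
have [ca ader aa0 aT apos] := scale.
have [_ wodd [wdx _ _ _ _] _ _] := sol.
have w00 t : 0 <= t -> (t%:E < Tbar)%E -> w t 0 = 0.
  by move=> t0 tT; have := wodd t t0 tT 0; rewrite oppr0; clear; lra.
have a00 : 0 < a 0 by apply: apos; rewrite lexx.
have bar_ge0 x : 0 < x -> 0 <= barrier p a 0 x.
  by move=> x0; rewrite barrierE// ?cusp_profile_ge0// ltW.
have init_lt x : 0 < x -> barrier p a 0 x < w 0 x.
  move=> x0; apply: le_lt_trans (w0gt x x0).
  by rewrite ler_peMl ?bar_ge0// lerDl ltW.
have init x : 0 <= x -> cusp_profile p (a 0) x <= w 0 x.
  rewrite le_eqVlt => /predU1P[<-|x0]; last by rewrite -barrierE ?ltW ?init_lt.
  by rewrite w00// /cusp_profile add0r subrr.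
have above t x : 0 <= t -> t < T -> (t%:E < Tbar)%E -> 0 <= x ->
    cusp_profile p (a t) x <= w t x.
  move=> t0 tT tTbar x0; apply: (solution_ge_cusp g01 hp qg erefl scale sol init t0 tT tTbar) => //.
  by rewrite t0 lexx.
have strict t x : 0 <= t -> t < T -> (t%:E < Tbar)%E -> 0 < x ->
    barrier p a t x < w t x.
  rewrite le_eqVlt => /predU1P[<- _ _|t0 tT tTbar x0]; first exact: init_lt.
  rewrite barrierE ?(ltW x0)//; last by apply: apos; rewrite ltW.
  exact: (solution_gt_cusp g01 hp qg erefl scale sol init t0 tT tTbar).
have slope t : 0 <= t -> t < T -> (t%:E < Tbar)%E ->
    p * a t `^ (p - 1) <= dx w t 0.
  move=> t0 tT tTbar; have At0 : 0 < a t by apply: apos; rewrite t0.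
  have dw := derivable_is_derive1 (wdx t 0 t0 tTbar).
  apply: (cusp_slope_le At0 dw (w00 t t0 tTbar)) => x x0.
  exact: above.
have a_small eta : 0 < eta -> \forall t \near T^'-, [/\ 0 <= t, t < T, 0 < a t & a t < eta].
  move=> eta0; near=> t.
  have t0 : 0 <= t by near: t; exact: nbhs_left_ge.
  have tT : t < T by near: t; exact: nbhs_left_lt.
  split => //; first by apply: apos; rewrite t0.
  by near: t; exact: (cvgr_lt _ (barrier_scale_cvg0 T0 scale) eta eta0).
have blowup : (T%:E <= Tbar)%E -> dx w t 0 @[t --> T^'-] --> +oo.
  move=> TT; apply/cvgryPge => M.
  have [|eta eta0 heta] := @powR_neg_ge R (p - 1) (M / p); first by rewrite subr_lt0.
  near=> t.
  have [t0 tT at0 ateta] : [/\ 0 <= t, t < T, 0 < a t & a t < eta].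
    by near: t; exact: a_small.
  have tTbar : (t%:E < Tbar)%E by apply: lt_le_trans TT; rewrite lte_fin.
  apply: le_trans (slope t t0 tT tTbar).
  by rewrite mulrC -ler_pdivrMr// heta.
have TbarT : (Tbar <= T%:E)%E.
  rewrite leNgt; apply/negP => TT.
  have lim := dx_cvg_left T0 TT sol.
  have lt1 : dx w T 0 < dx w T 0 + 1 by rewrite ltrDl.
  have h1 := cvgr_lt _ lim _ lt1.
  have h2 := (cvgryPge _).1 (blowup (ltW TT)) (dx w T 0 + 1).
  suff : \forall t \near T^'-, False by move/filter_ex => -[].
  near=> t.
  have l1 : dx w t 0 < dx w T 0 + 1 by near: t; exact: h1.
  have l2 : dx w T 0 + 1 <= dx w t 0 by near: t; exact: h2.
  by move: l1; rewrite ltNge l2.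
split => //.
- by move=> t x t0 tTbar x0; apply: strict => //; rewrite -lte_fin (lt_le_trans tTbar).
- move=> TbarE; split; first by apply: blowup; rewrite TbarE.
  move=> e e0; near=> t.
  have [t0 tT at0 ate] : [/\ 0 <= t, t < T, 0 < a t & a t < e `^ p^-1].
    by near: t; apply: a_small; rewrite powR_gt0.
  have tTbar : (t%:E < Tbar)%E by rewrite TbarE lte_fin.
  have ape : a t `^ p < e.
    have -> : e = (e `^ p^-1) `^ p by rewrite -powRrM mulVf ?gt_eqF// powRr1// ltW.
    by apply: powR_lt => //; exact: ltW.
  have pos x : 0 < x -> x `^ p - e < w t x.
    move=> x0; apply: (@lt_le_trans _ _ (cusp_profile p (a t) x)); last first.
      by apply: above => //; exact: ltW.
    apply: (@lt_le_trans _ _ (x `^ p - a t `^ p)); first by rewrite ltrD2l ltrN2.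
    by rewrite lerD2r; apply: powR_le; rewrite ?lerDl ltW.
  move=> x; have [x0|x0|->] := ltgtP x 0.
  + rewrite ltr0_norm// ltr0_sg// mulN1r -(wodd t t0 tTbar) pos// oppr_gt0//.
  + by rewrite gtr0_norm// gtr0_sg// mul1r pos.
  + by rewrite normr0 powR0 ?gt_eqF// sgr0 mul0r sub0r oppr_lt0.
Unshelve. all: by end_near. Qed.
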